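(* For every $\delta > 0$ there is a constant $C = C(\delta) > 0$ such that the following holds for all positive integers $n$, $S$ and $K$. Put $T = \exp(C\, n \log(nK))$. Suppose that $$\max_{x \in \mathbb{R}/\mathbb{Z}} \sum_{a \in A} S_K(ax) \geq \frac{S}{3} + \delta$$ for every set $A$ of $n$ integers contained in $[1,T]$. Then $m_A \geq S/3$ for every set $A \subset \mathbb{Z}_{>0}$ of size $n$.
   Context: Let $f:\mathbb{R}\to\mathbb{R}$ be the $1$-periodic function with $f(x) = 1_{[1/3,2/3)}(x) - 1/3$ for $x \in [0,1)$. For a finite set $A \subset \mathbb{Z}_{>0}$ put $f_A(x) = \sum_{a \in A} f(ax)$ and $m_A = \max_{x \in \mathbb{R}} f_A(x)$. Write $e(x) = e^{2\pi i x}$. For a positive integer $K$, the Selberg polynomial $S_K$ (a minorant of $f$) is $$S_K(x) = - B_K(2/3 - x) - B_K(x - 1/3),$$ where $$B_K(x) = V_K(x) + \frac{1}{2(K+1)} \Delta_{K+1}(x), \qquad \Delta_{L}(x) = \sum_{|k| \leq L} \left(1 - \frac{|k|}{L}\right) e(kx),$$ $$V_K(x) = \frac{1}{K+1} \sum_{k=1}^K \left(\frac{k}{K+1} - \frac12\right) \Delta_{K+1}\left(x - \frac{k}{K+1}\right) + \frac{1}{2\pi(K+1)} \sin(2\pi(K+1)x) - \frac{1}{2\pi} \Delta_{K+1}(x) \sin(2\pi x).$$ Known properties: $S_K$ is an even real trigonometric polynomial with Fourier support in $\{-K,\dots,K\}$, $S_K \leq f$, $\int_0^1 (f - S_K) \leq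 \frac{1}{K+1}$, and $\|S_K\|_\infty = O(1)$ uniformly in $K$. *)

(* Defs.v *)
From HB Require Import structures.
From mathcomp Require Import all_boot all_order all_algebra finmap.
From mathcomp Require Import complex ring lra.
From mathcomp Require Import all_classical all_reals all_analysis.
Set Implicit Arguments.
Unset Strict Implicit.
Unset Printing Implicit Defensive.
Import Order.TTheory GRing.Theory Num.Theory.
Import numFieldNormedType.Exports.
Local Open Scope classical_set_scope.
Local Open Scope ring_scope.
Local Open Scope complex_scope.

Section Definitions.
Variable R : realType.
Implicit Types (x : R) (K L : nat) (A : {fset nat}).

Definition f x : R :=
  \1_(`[1 / 3, 2 / 3[%classic : set R) (x - (Num.floor x)%:~R) - 1 / 3.

Definition fsum A x : R := \sum_(a <- A) f (a%:R * x).

(* [sup] stands for the maximum over all real arguments; lemmas [mE] and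
   [mSE] below show that it is attained in both cases where it is used. *)
Definition m A : R := sup (range (fsum A)).

Definition e x : R[i] := cos (2 * pi * x) +i* sin (2 * pi * x).

(* The summation index is k = j - L for 0 <= j <= 2L.  *)
Definition DeltaC L x : R[i] :=
  \sum_(j < (2 * L).+1)
    let k : int := j%:Z - L%:Z in
    (1 - `|k|%:~R / L%:R)%:C * e (k%:~R * x).

(* No information is lost by taking the real part, see [DeltaE]. *)
Definition Delta L x : R := complex.Re (DeltaC L x).

Definition V K x : R :=
  K.+1%:R^-1 *
    (\sum_(1 <= k < K.+1)
       (k%:R / K.+1%:R - 1 / 2) * Delta K.+1 (x - k%:R / K.+1%:R))
  + (2 * pi * K.+1%:R)^-1 * sin (2 * pi * K.+1%:R * x)
  - (2 * pi)^-1 * Delta K.+1 x * sin (2 * pi * x).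

Definition B K x : R := V K x + (2 * K.+1%:R)^-1 * Delta K.+1 x.

Definition selberg K x : R := - B K (2 / 3 - x) - B K (x - 1 / 3).

Definition selberg_sum K A x : R := \sum_(a <- A) selberg K (a%:R * x).

Definition mS K A : R := sup (range (selberg_sum K A)).

Lemma f_periodic x : f (x + 1) = f x.
Proof.
rewrite /f; congr (\1_ _ _ - _).
by rewrite floorDrz ?rpred1// floor1 intrD; ring.
Qed.

Lemma sup_range_max (g : R -> R) x :
  (forall y, g y <= g x) -> sup (range g) = g x.
Proof.
move=> gx; apply/eqP; rewrite eq_le; apply/andP; split.
  by apply: ge_sup; [exists (g x), x|move=> _ [y _ <-]].
by apply: ub_le_sup; [exists (g x) => _ [y _ <-]|exists x].
Qed.

Lemma mE A : exists2 x, m A = fsum A x & forall y, fsum A y <= fsum A x.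
Proof.
suff [x gx] : exists x, forall y, fsum A y <= fsum A x.
  by exists x => //; exact: sup_range_max.
pose b x : bool := (x - (Num.floor x)%:~R) \in (`[1 / 3, 2 / 3[%classic : set R).
pose N x := (\sum_(a <- A) b (a%:R * x)%R)%N.
have fN x : fsum A x = (N x)%:R - \sum_(a <- A) 1 / 3.
  by rewrite /fsum /N natr_sum -sumrB; apply: eq_bigr => a _; rewrite /f indicE.
have Nle x : (N x <= \sum_(a <- A) 1)%N by apply: leq_sum => a _; exact: leq_b1.
pose P k := `[< exists x, N x = k >].
have exP : exists k, P k by exists (N 0); apply/asboolP; exists 0.
have leP k : P k -> (k <= \sum_(a <- A) 1)%N by move=> /asboolP[x <-].
case: (ex_maxnP exP leP) => k /asboolP[x <-] kmax.
exists x => y; rewrite !fN lerD2r ler_nat; apply: kmax.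
by apply/asboolP; exists y.
Qed.

Lemma Re_sum I (r : seq I) (F : I -> R[i]) :
  complex.Re (\sum_(i <- r) F i) = \sum_(i <- r) complex.Re (F i).
Proof. by elim/big_rec2: _ => // i x [a b] _ /= <-; case: (F i). Qed.

Lemma Im_sum I (r : seq I) (F : I -> R[i]) :
  complex.Im (\sum_(i <- r) F i) = \sum_(i <- r) complex.Im (F i).
Proof. by elim/big_rec2: _ => // i x [a b] _ /= <-; case: (F i). Qed.

Lemma DeltaE L x : (Delta L x)%:C = DeltaC L x.
Proof.
suff Im0 : complex.Im (DeltaC L x) = 0.
  by rewrite /Delta; case: (DeltaC L x) Im0 => a b /= ->.
rewrite /DeltaC Im_sum; set s := (LHS).
suff : s = - s by move=> ?; lra.
rewrite {1}/s (reindex_inj rev_ord_inj)/= -sumrN; apply: eq_bigr => j _ /=.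
have jL : (j <= 2 * L)%N by rewrite -ltnS.
have -> : (((2 * L).+1 - j.+1)%N%:Z - L%:Z = - (j%:Z - L%:Z) :> int).
  by rewrite subSS -subzn// PoszM; ring.
rewrite normrN intrN mulNr mulrN sinN; ring.
Qed.

Let trigI (F : R -> R) (k : int) x : periodic F (pi *+ 2) ->
  F (2 * pi * (k%:~R * (x + 1))) = F (2 * pi * (k%:~R * x)).
Proof.
move=> pF; case: k => n.
  by rewrite -[RHS](periodicn pF n); congr F; rewrite -pmulrn -[pi *+ 2 *+ n]mulr_natr -[pi *+ 2]mulr_natr; ring.
rewrite -[LHS](periodicn pF n.+1) NegzE; congr F.
by rewrite intrN -pmulrn -[pi *+ 2 *+ _]mulr_natr -[pi *+ 2]mulr_natr; ring.
Qed.

Lemma Delta_periodic L x : Delta L (x + 1) = Delta L x.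
Proof.
rewrite /Delta /DeltaC; congr complex.Re; apply: eq_bigr => j _.
by rewrite /e trigI; [rewrite trigI; last exact: sinD2pi|exact: cosD2pi].
Qed.

Lemma B_periodic K x : B K (x + 1) = B K x.
Proof.
rewrite /B /V Delta_periodic.
under eq_bigr do rewrite addrAC Delta_periodic.
have := trigI K.+1 x (@sinD2pi R); have := trigI 1 x (@sinD2pi R).
by rewrite !mul1r -!pmulrn !mulrA => -> ->.
Qed.

Lemma selberg_periodic K x : selberg K (x + 1) = selberg K x.
Proof.
rewrite /selberg [x + 1 - _]addrAC B_periodic; congr (- _ - _).
by rewrite -[LHS]B_periodic; congr B; ring.
Qed.

Lemma selberg_sum_periodic K A x : selberg_sum K A (x + 1) = selberg_sum K A x.
Proof.
apply: eq_bigr => a _; rewrite mulrDr mulr1.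
elim: a (a%:R * x) => [|a IH] y; first by rewrite addr0.
by rewrite -natr1 addrA selberg_periodic IH.
Qed.

Let cst_continuous_R (c : R) : continuous (fun _ : R => c).
Proof. by move=> ?; exact: cvg_cst. Qed.

Let sum_continuous I (r : seq I) (F : I -> R -> R) :
  (forall i, continuous (F i)) -> continuous (fun x => \sum_(i <- r) F i x).
Proof. by move=> cF; apply: continuous_big => //; exact: add_continuous. Qed.

Let affine_continuous (c d : R) : continuous (fun x => c * x + d).
Proof.
move=> x; apply: cvgD; last exact: cvg_cst.
by apply: cvgM; [exact: cvg_cst|exact: cvg_id].
Qed.

Lemma Delta_continuous L : continuous (@Delta L).
Proof.
have -> : @Delta L = fun x => \sum_(j < (2 * L).+1)
    (1 - `|j%:Z - L%:Z|%:~R / L%:R) *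
    cos (2 * pi * (j%:Z - L%:Z)%:~R * x + 0).
  apply/funext => x; rewrite /Delta /DeltaC Re_sum; apply: eq_bigr => j _ /=.
  by rewrite mul0r subr0 addr0 !mulrA.
apply: sum_continuous => j x; apply: cvgM; first exact: cvg_cst.
apply: continuous_comp; first exact: affine_continuous.
exact: continuous_cos.
Qed.

Lemma B_continuous K : continuous (@B K).
Proof.
have cD c x : {for x, continuous (fun x => Delta K.+1 (x - c))}.
  apply: continuous_comp; last exact: Delta_continuous.
  by apply: cvgB; [exact: cvg_id|exact: cvg_cst].
have cs c x : {for x, continuous (fun x : R => sin (c * x))}.
  apply: continuous_comp; last exact: continuous_sin.
  by apply: cvgM; [exact: cvg_cst|exact: cvg_id].
move=> x; apply: cvgD; last first.
  by apply: cvgM; [exact: cvg_cst|exact: Delta_continuous].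
apply: cvgB; first apply: cvgD.
- apply: cvgM; first exact: cvg_cst.
  apply: sum_continuous => k {}x; apply: cvgM; first exact: cvg_cst.
  exact: cD.
- by apply: cvgM; [exact: cvg_cst|exact: cs].
- apply: cvgM; last exact: cs.
  by apply: cvgM; [exact: cvg_cst|exact: Delta_continuous].
Qed.

Lemma selberg_sum_continuous K A : continuous (@selberg_sum K A).
Proof.
apply: sum_continuous => a x.
have -> : (fun x => selberg K (a%:R * x)) =
  fun x => - B K ((- a%:R) * x + 2 / 3) - B K (a%:R * x + (- (1 / 3))).
  by apply/funext => y; rewrite /selberg mulNr [2 / 3 - _]addrC.
apply: cvgB; first apply: cvgN.
- apply: (@continuous_comp _ _ _ (fun x => - a%:R * x + 2 / 3) (B K)).
    exact: affine_continuous.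
  exact: B_continuous.
- apply: (@continuous_comp _ _ _ (fun x => a%:R * x + - (1 / 3)) (B K)).
    exact: affine_continuous.
  exact: B_continuous.
Qed.

Lemma mSE K A : exists2 x,
  mS K A = selberg_sum K A x & forall y, selberg_sum K A y <= selberg_sum K A x.
Proof.
suff [x gx] : exists x, forall y, selberg_sum K A y <= selberg_sum K A x.
  by exists x => //; exact: sup_range_max.
have [|x _ xmax] := @EVT_max R (selberg_sum K A) 0 1 ler01.
  exact/continuous_subspaceT/selberg_sum_continuous.
exists x => y; have pz n z : selberg_sum K A (z + n%:R) = selberg_sum K A z.
  by elim: n => [|n IH]; rewrite ?addr0// -natr1 addrA selberg_sum_periodic.
have -> : selberg_sum K A y = selberg_sum K A (y - (Num.floor y)%:~R).
  case: (Num.floor y) => n; first by rewrite -[RHS](pz n) subrK.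
  by rewrite NegzE intrN opprK -pmulrn pz.
apply: xmax; rewrite in_itv/= subr_ge0 floor_le/=.
by have := floor_itv y; rewrite intrD => /andP[_ /ltW]; lra.
Qed.

End Definitions.

(* Main.v *)
Require Import Defs.
From HB Require Import structures.
From mathcomp Require Import all_boot all_order all_algebra finmap.
From mathcomp Require Import perm complex ring lra zify.
From mathcomp Require Import all_classical all_reals all_analysis.
Set Implicit Arguments.
Unset Strict Implicit.
Unset Printing Implicit Defensive.
Import Order.TTheory GRing.Theory Num.Theory.
Import numFieldNormedType.Exports.
Local Open Scope ring_scope.

(** Minorant.  With N = K+1, v_k = pi (x - k/N) and h(v) = v cot v, the
    closed form of the Fejer kernel gives, for 0 < x < 1,
      B_K(x) - (x - 1/2)
        = sin^2(pi N x) / (pi N^2) * (sum_(1 <= k <= N) h'(v_k) - N cot(pi x)),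
    which is nonnegative because h is concave on (-pi, pi): the tangent
    inequalities at the v_k telescope.  Hence S_K <= f at irrational points, and
    by continuity sum_(a in A) S_K(a x) <= m_A everywhere.

    Transfer.  Given A = {a_i}, a vertex of the polyhedron cut out by the linear
    relations of length at most q among the a_i and by the strict order of the a_i
    yields, after clearing a determinant, a set A' = {a'_i} of n positive integers
    at most n! q^(n-1) that satisfies all these relations.  Averaging
    |1 + sum_i e(a_i x - a'_i x0)|^(2q) over x then only sees pairs of words in
    the letters {0, a_1, ..., a_n} with equal sums, on which the phase a' x0
    cancels; Cauchy-Schwarz bounds the average below by (n+1)^(2q) / (q+1)^n.
    So some x has every a_i x close to a'_i x0 modulo 1, with a quality polynomial
    in n K / delta when q is polynomial in n K / delta, and the Lipschitz bound
    for S_K transfers the lower bound from A' at x0 to A at x. *)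

(** * Concavity of v cot v on (-pi, pi) *)

Section Trigonometry.
Variable R : realType.
Implicit Types (x y v w d : R).

Lemma sin_le_id x : 0 <= x -> sin x <= x.
Proof.
move=> x0; have [c _ E] := @MVT_segment R sin cos 0 x x0 (fun c _ => is_derive_sin c)
  (continuous_subspaceT (@continuous_sin R)).
move: E; rewrite sin0 !subr0 => ->.
by rewrite ler_piMl// cos_le1.
Qed.

(** The derivative of sin z - z cos z is z sin z, which is nonnegative on [0, pi]. *)
Lemma id_mul_cos_le_sin x : 0 <= x <= pi -> x * cos x <= sin x.
Proof.
move=> /andP[x0 xpi]; rewrite -subr_ge0.
pose F z : R := sin z - z * cos z.
have dF (z : R) : is_derive z 1 F (z * sin z).
  by apply: is_derive_eq; rewrite /GRing.scale/=; ring.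
have [|c cx E] := @MVT_segment R F (fun z => z * sin z) 0 x x0 (fun c _ => dF c).
  apply: continuous_subspaceT => z; apply: differentiable_continuous.
  apply/derivable1_diffP; exact: (@ex_derive _ _ _ _ _ _ _ (dF z)).
move: E; rewrite /F sin0 mul0r !subr0 => ->.
move: cx; rewrite in_itv/= => /andP[c0 cx].
by rewrite !mulr_ge0// sin_ge0_pi// c0 (le_trans cx).
Qed.

Lemma sin_mul_cos_le x : 0 <= x -> sin x * cos x <= x.
Proof.
move=> x0; have := @sin_le_id (x + x); rewrite sinD => h.
have := h ltac:(lra); lra.
Qed.

Lemma sqr_sin_le x : 0 <= x <= pi -> sin x ^+ 2 <= x ^+ 2.
Proof.
move=> /andP[x0 xpi]; rewrite ler_sqr ?nnegrE ?sin_ge0_pi ?x0 ?xpi//.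
exact: sin_le_id.
Qed.

(* Tangent line inequality for the concave function [v * cot v] on (-pi, pi). *)
Lemma tangent_mul_cot v w : - pi < v -> v < w -> w < pi -> w - v <= pi ->
  v != 0 -> w != 0 ->
  w * (cos w / sin w) - v * (cos v / sin v) <=
  (w - v) * (cos v / sin v - v / sin v ^+ 2).
Proof.
move=> piv vw wpi wvpi v0 w0.
have sv0 : sin v != 0.
  case: (ltgtP v 0) v0 => // h _.
    by rewrite -oppr_eq0 -sinN gt_eqF// sin_gt0_pi//; lra.
  by rewrite gt_eqF// sin_gt0_pi//; lra.
have sw0 : sin w != 0.
  case: (ltgtP w 0) w0 => // h _.
    by rewrite -oppr_eq0 -sinN gt_eqF// sin_gt0_pi//; lra.
  by rewrite gt_eqF// sin_gt0_pi//; lra.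
have sd0 : 0 <= sin (w - v) by rewrite sin_ge0_pi//; lra.
set d := w - v in sd0 *.
have wE : w = v + d by rewrite /d; ring.
have d0 : 0 < d by rewrite /d; lra.
rewrite -subr_ge0.
have -> : d * (cos v / sin v - v / sin v ^+ 2) -
   (w * (cos w / sin w) - v * (cos v / sin v)) =
   (w * sin d * sin v - v * d * sin w) / (sin w * sin v ^+ 2).
  have -> : w * sin d * sin v = w * (sin w * cos v - cos w * sin v) * sin v.
    by rewrite /d sinB.
  rewrite /d; field; exact/andP.
have hd := @id_mul_cos_le_sin d ltac:(rewrite /d; lra).
(* The denominator has the sign of w. Each of the patterns v < w < 0, v < 0 < w and 0 < v < w has
   its own decomposition of the numerator into products of factors of known sign. *)
case: (ltgtP w 0) w0 => // hw _.
- have -> : sin w * sin v ^+ 2 = - (sin (- w) * sin v ^+ 2) by rewrite sinN; ring.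
  rewrite invrN mulrN -mulNr divr_ge0//; last first.
    by rewrite mulr_ge0 ?sqr_ge0// sin_ge0_pi//; lra.
  have -> : - (w * sin d * sin v - v * d * sin w) =
     - w * sin (- w) * (d - sin d * cos d) +
     sin d ^+ 2 * (sin (- w) - - w * cos (- w)) +
     sin (- w) * (d ^+ 2 - sin d ^+ 2).
    have -> : v = w - d by rewrite wE; ring.
    by rewrite sinB sinN cosN; ring.
  have h1 := @id_mul_cos_le_sin (- w) ltac:(lra).
  have h2 := @sin_mul_cos_le d (ltW d0).
  have h3 : sin d ^+ 2 <= d ^+ 2 by apply: sqr_sin_le; lra.
  have h4 : 0 <= sin (- w) by rewrite sin_ge0_pi//; lra.
  by rewrite !addr_ge0// ?mulr_ge0//; rewrite ?sqr_ge0//; lra.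
- have sw : 0 < sin w by rewrite sin_gt0_pi//; lra.
  apply: divr_ge0; last by rewrite mulr_ge0 ?sqr_ge0// ltW.
  case: (ltgtP v 0) v0 => // hv _.
  + have -> : w * sin d * sin v - v * d * sin w =
       w * sin w * (- v - sin (- v) * cos (- v))
       + (sin w - w * cos w) * sin (- v) ^+ 2
       + sin w * ((- v) ^+ 2 - sin (- v) ^+ 2).
      by rewrite /d sinB sinN cosN; ring.
    have h1 := @id_mul_cos_le_sin w ltac:(lra).
    have h2 := @sin_mul_cos_le (- v) ltac:(lra).
    have h3 : sin (- v) ^+ 2 <= (- v) ^+ 2 by apply: sqr_sin_le; lra.
    have h4 := sqr_ge0 (sin (- v)).
    have h5 : 0 <= w * sin w by rewrite mulr_ge0// ltW.
    by do ?apply: addr_ge0; apply: mulr_ge0 => //; lra.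
  + rewrite wE sinD.
    have -> : (v + d) * sin d * sin v - v * d * (sin v * cos d + cos v * sin d) =
      v * sin v * (sin d - d * cos d) + d * sin d * (sin v - v * cos v) by ring.
    have := @id_mul_cos_le_sin v ltac:(lra).
    have : 0 < sin v by rewrite sin_gt0_pi//; lra.
    by move=> s0 h; rewrite !addr_ge0// ?mulr_ge0//; lra.
Qed.
End Trigonometry.

(** * The Fejer kernel: closed form and sums over equally spaced shifts *)

Section Fejer.
Variable R : realType.
Implicit Types (x y b c : R) (N k j : nat).

Lemma sin_natpi N : sin (pi * N%:R) = 0 :> R.
Proof.
by elim: N => [|N IH]; rewrite ?mulr0 ?sin0// -natr1 mulrDr mulr1 sinDpi IH oppr0.
Qed.

Lemma sin_sub_natpi c N : sin (c - 2 * (pi * N%:R)) = sin c.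
Proof.
rewrite -[LHS](periodicn (@sinD2pi R) N); congr sin.
by rewrite -[pi *+ 2 *+ N]mulr_natr -[pi *+ 2]mulr_natr; ring.
Qed.

Lemma sin_rat_neq0 N m : (0 < m < N)%N -> sin (pi * m%:R / N%:R) != 0 :> R.
Proof.
case/andP=> m0 mN; have N0 : (0 : R) < N%:R by rewrite ltr0n (leq_trans _ mN).
rewrite gt_eqF// sin_gt0_pi//; apply/andP; split.
  by rewrite divr_gt0// mulr_gt0 ?pi_gt0 ?ltr0n.
by rewrite ltr_pdivrMr// ltr_pM2l ?pi_gt0// ltr_nat.
Qed.

(** Multiplication by sin(pi m / N), nonzero for 0 < m < N, makes the sum telescope; the two end
    terms differ by a whole number of periods. *)
Lemma sum_cos_equidistributed N m c : (0 < m < N)%N ->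
  \sum_(k < N) cos (c - 2 * (pi * m%:R * k%:R / N%:R)) = 0.
Proof.
move=> mN; pose b : R := pi * m%:R / N%:R.
have sb0 : sin b != 0 by exact: sin_rat_neq0.
apply: (mulfI sb0); rewrite mulr0 mulr_sumr.
pose S k : R := sin (c + b - 2 * (k%:R * b)) / 2.
transitivity (\sum_(k < N) - (S k.+1 - S k)).
  apply: eq_bigr => k _; rewrite /S.
  have -> : c + b - 2 * (k.+1%:R * b) = c - 2 * (k%:R * b) - b.
    by rewrite -natr1; ring.
  have -> : c + b - 2 * (k%:R * b) = c - 2 * (k%:R * b) + b by ring.
  have -> : c - 2 * (pi * m%:R * k%:R / N%:R) = c - 2 * (k%:R * b) by rewrite /b; ring.
  set X := c - _; by rewrite sinB sinD; field.
rewrite sumrN -(big_mkord xpredT (fun k => S k.+1 - S k)) telescope_sumr//.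
have -> : S N = S 0%N; last by rewrite subrr oppr0.
rewrite /S mul0r mulr0 subr0; congr (_ / _).
have -> : N%:R * b = pi * m%:R; last exact: sin_sub_natpi.
rewrite /b; field.
by rewrite pnatr_eq0; case: N mN {b sb0 S} => //; case: m.
Qed.

Lemma DeltaRe N x : Delta N x = \sum_(j < (2 * N).+1)
    (1 - `|j%:Z - N%:Z|%:~R / N%:R) * cos (2 * pi * ((j%:Z - N%:Z)%:~R * x)).
Proof.
rewrite /Delta /DeltaC Re_sum; apply: eq_bigr => j _ /=.
by rewrite mul0r subr0.
Qed.

Let G x (k : int) : R := cos (2 * pi * (k%:~R * x)).

Let Dirichlet N x : R := \sum_(j < (2 * N).+1) G x (j%:Z - N%:Z).

Lemma sum_two_sided_rec (V : zmodType) (F : int -> V) N :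
  \sum_(j < (2 * N.+1).+1) F (j%:Z - N.+1%:Z) =
  \sum_(j < (2 * N).+1) F (j%:Z - N%:Z) + (F (- N.+1%:Z) + F N.+1%:Z).
Proof.
have -> : (2 * N.+1)%N = (2 * N).+2 by rewrite mulnS.
rewrite big_ord_recl big_ord_recr/= sub0r [RHS]addrCA; congr (_ + _).
congr (_ + _).
  by apply: eq_bigr => j _; congr F; rewrite /bump/= add1n; lia.
by congr F; rewrite /bump/= add1n; lia.
Qed.

Let DirichletE N x : Dirichlet N x * sin (pi * x) = sin ((2 * N%:R + 1) * (pi * x)).
Proof.
elim: N => [|N IH].
  by rewrite /Dirichlet big_ord1/= /G subrr mul0r mulr0 cos0 mul1r mulr0 add0r mul1r.
rewrite /Dirichlet sum_two_sided_rec mulrDl IH.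
have -> : G x (- N.+1%:Z) = G x N.+1%:Z by rewrite /G intrN mulNr mulrN cosN.
rewrite /G -pmulrn.
have -> : (2 * N%:R + 1) * (pi * x) = 2 * pi * (N.+1%:R * x) - pi * x.
  by rewrite -natr1; ring.
have -> : (2 * N.+1%:R + 1) * (pi * x) = 2 * pi * (N.+1%:R * x) + pi * x by ring.
by rewrite sinB sinD; ring.
Qed.

(** This is N times the Fejer kernel. With the unnormalized weights N - |k|, passing from N to N + 1
    adds exactly one Dirichlet kernel. *)
Let wG N x : R := \sum_(j < (2 * N).+1)
    (N%:R - `|j%:Z - N%:Z|%:~R) * G x (j%:Z - N%:Z).

Let wGE N x : wG N x * sin (pi * x) ^+ 2 = sin (N%:R * (pi * x)) ^+ 2.
Proof.
elim: N => [|N IH].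
  by rewrite /wG big_ord1/= normr0 !subrr !mul0r sin0 expr0n.
have -> : wG N.+1 x = wG N x + Dirichlet N x.
  rewrite /wG (@sum_two_sided_rec _ (fun z : int => (N.+1%:R - `|z|%:~R) * G x z)).
  rewrite normrN ger0_norm// -pmulrn subrr !mul0r !addr0 -big_split/=.
  by apply: eq_bigr => j _; rewrite -natr1; ring.
rewrite mulrDl IH [sin (pi * x) ^+ 2]expr2 [Dirichlet _ _ * _]mulrA DirichletE.
(* With a = N pi x and b = (N + 1) pi x, what remains is sin(b + a) sin(b - a) = sin^2 b - sin^2
   a. *)
have -> : (2 * N%:R + 1) * (pi * x) = N.+1%:R * (pi * x) + N%:R * (pi * x).
  by rewrite -natr1; ring.
have -> : sin (pi * x) = sin (N.+1%:R * (pi * x) - N%:R * (pi * x)).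
  by congr sin; rewrite -natr1; ring.
rewrite sinD sinB.
set a := N%:R * _; set b := _.+1%:R * _.
have := cos2Dsin2 a; have := cos2Dsin2 b => hb ha.
rewrite !expr2 in ha hb *.
have -> : (sin b * cos a + cos b * sin a) * (sin b * cos a - cos b * sin a) =
 (sin b * sin b) * (cos a * cos a) - (cos b * cos b) * (sin a * sin a) by ring.
have -> : cos a * cos a = 1 - sin a * sin a by lra.
have -> : cos b * cos b = 1 - sin b * sin b by lra.
ring.
Qed.

Lemma Delta_closed N x : (0 < N)%N ->
  N%:R * Delta N x * sin (pi * x) ^+ 2 = sin (N%:R * (pi * x)) ^+ 2.
Proof.
move=> N0; rewrite -wGE; congr (_ * _); rewrite DeltaRe mulr_sumr.
apply: eq_bigr => j _; rewrite mulrA; congr (_ * _).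
by field; rewrite pnatr_eq0 -lt0n.
Qed.

(** Summing over the shifts k / N annihilates the frequencies strictly between 0 and N in absolute
    value, and those of absolute value N carry weight zero; only the constant term survives. *)
Lemma sum_Delta_shift N x : (0 < N)%N ->
  \sum_(k < N) Delta N (x - k%:R / N%:R) = N%:R.
Proof.
move=> N0; have N0R : N%:R != 0 :> R by rewrite pnatr_eq0 -lt0n.
under eq_bigr do rewrite DeltaRe.
have Nlt : (N < (2 * N).+1)%N by rewrite ltnS leq_pmull.
rewrite exchange_big/= (bigD1 (Ordinal Nlt))//= [X in _ + X]big1 ?addr0 => [|j jN].
  under eq_bigr do rewrite subrr normr0 !mul0r subr0 mulr0 cos0 mulr1.
  by rewrite sumr_const card_ord.
set z := j%:Z - N%:Z; rewrite -mulr_sumr.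
pose mm := `|z|%N.
have zE : (`|z|%:~R : R) = mm%:R by rewrite -natr_absz.
have cE k : cos (2 * pi * (z%:~R * (x - k%:R / N%:R))) =
            cos (2 * pi * (mm%:R * (x - k%:R / N%:R))) :> R.
  have [z0|z0] := leP 0 z.
    by rewrite -zE ger0_norm.
  by rewrite -zE ltr0_norm// intrN !mulNr mulrN cosN.
have [mN|mN] := eqVneq mm N.
  by rewrite zE mN divff// subrr mul0r.
rewrite [X in _ * X](_ : _ = 0) ?mulr0//.
under eq_bigr do rewrite cE.
transitivity (\sum_(k < N) cos (2 * pi * mm%:R * x - 2 * (pi * mm%:R * k%:R / N%:R)) : R).
  by apply: eq_bigr => k _; congr cos; ring.
apply: sum_cos_equidistributed; apply/andP; split.
  rewrite /mm absz_gt0 /z subr_eq0; apply: contra jN => /eqP[jN].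
  exact/eqP/val_inj.
rewrite ltn_neqAle mN /mm /z.
have := ltn_ord j; lia.
Qed.

(** Conjugate Dirichlet kernel with half weight at the last frequency: it exhibits 2 sin^2(pi N x)
    cot(pi x) as a sine polynomial. *)
Lemma conjugate_kernel_closed N x :
  (\sum_(j < N) 2 * sin (2 * (pi * j%:R * x)) + sin (2 * (pi * N%:R * x))) * sin (pi * x)
  = 2 * sin (N%:R * (pi * x)) ^+ 2 * cos (pi * x).
Proof.
elim: N => [|N IH].
  by rewrite big_ord0 mulr0 !mul0r mulr0 sin0 add0r expr0n/= mulr0 !mul0r.
rewrite big_ord_recr/= -addrA mulrDl.
set A := \sum_(_ < _) _ in IH *.
have -> : A * sin (pi * x) = 2 * sin (N%:R * (pi * x)) ^+ 2 * cos (pi * x)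
    - sin (2 * (pi * N%:R * x)) * sin (pi * x).
  by rewrite -IH; ring.
set y := pi * x; set a := N%:R * y.
have -> : 2 * (pi * N%:R * x) = a + a by rewrite /a /y; ring.
have -> : 2 * (pi * N.+1%:R * x) = (a + y) + (a + y) by rewrite /a /y -natr1; ring.
have -> : N.+1%:R * y = a + y by rewrite /a -natr1; ring.
rewrite !(sinD, cosD).
have := cos2Dsin2 a; have := cos2Dsin2 y => hb ha.
rewrite !expr2 in ha hb *.
have ha' : cos a * cos a = 1 - sin a * sin a by lra.
have hb' : cos y * cos y = 1 - sin y * sin y by lra.
ring: ha' hb'.
Qed.

(** By [conjugate_kernel_closed] each summand is a sine polynomial. Summing over the shifts kills
    the frequencies 0 < j < N, and the frequency N, unaffected by the shifts, is counted N times. *)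
Lemma sum_cot N x : (0 < N)%N ->
  (forall k, (k < N)%N -> sin (pi * (x - k%:R / N%:R)) != 0) ->
  2 * sin (N%:R * (pi * x)) ^+ 2 * 
  (\sum_(k < N) cos (pi * (x - k%:R / N%:R)) / sin (pi * (x - k%:R / N%:R)))
  = N%:R * sin (2 * (pi * N%:R * x)).
Proof.
move=> N0 sk; have N0R : N%:R != 0 :> R by rewrite pnatr_eq0 -lt0n.
have sinN2 k : sin (N%:R * (pi * (x - k%:R / N%:R))) ^+ 2 = sin (N%:R * (pi * x)) ^+ 2.
  have -> : N%:R * (pi * (x - k%:R / N%:R)) = N%:R * (pi * x) - pi * k%:R by field.
  rewrite sinB sin_natpi mulr0 subr0 exprMn cos2sin2 sin_natpi.
  by rewrite expr0n subr0 mulr1.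
rewrite mulr_sumr.
transitivity (\sum_(k < N) (\sum_(j < N) 2 * sin (2 * (pi * j%:R * (x - k%:R / N%:R)))
   + sin (2 * (pi * N%:R * x)))).
  apply: eq_bigr => k _; apply: (mulIf (sk k (ltn_ord k))).
  rewrite mulrA divfK ?sk// -(sinN2 k) -conjugate_kernel_closed; congr ((_ + _) * _).
  rewrite -[RHS](sin_sub_natpi _ k); congr sin; by field.
rewrite big_split/= sumr_const card_ord [RHS]mulr_natl exchange_big/= big1 ?add0r// => j _.
rewrite -mulr_sumr; case: (posnP j) => [->|j0].
  by rewrite big1 ?mulr0// => k _; rewrite mul0r mulr0 sin0.
rewrite [X in _ * X](_ : _ = 0) ?mulr0//.
have := @sum_cos_equidistributed N j (2 * (pi * j%:R * x) - pi / 2).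
rewrite j0 ltn_ord => /(_ isT) E0; rewrite -[RHS]E0; apply: eq_bigr => k _.
rewrite addrAC cosBpihalf; congr sin; ring.
Qed.

End Fejer.

(** * Majorization of the sawtooth x - 1/2 by [B K] on (0, 1) *)

Section Minorant.
Variable R : realType.
Implicit Types (x y : R) (K N k : nat).

Lemma B_ge_sawtooth_itv K x : (0 < K)%N -> 0 < x < 1 -> sin (K.+1%:R * (pi * x)) != 0 ->
  x - 1 / 2 <= B K x.
Proof.
move=> K0 /andP[x0 x1] sN; set N := K.+1 in sN *.
have p0 := @pi_gt0 R; have pn0 : (pi : R) != 0 by rewrite gt_eqF.
have N0 : (0 : R) < N%:R by rewrite ltr0n.
have N0n : N%:R != 0 :> R by rewrite gt_eqF.
pose v k : R := pi * (x - k%:R / N%:R).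
have v0E : v 0%N = pi * x by rewrite /v mul0r subr0.
have vNE : v N = pi * x - pi by rewrite /v; field.
have vS k : v k.+1 = v k - pi / N%:R by rewrite /v -natr1; field.
(* A zero of the sine at [v k] would make N x an integer, against the hypothesis. *)
have sv k : sin (v k) != 0.
  apply: contra sN => /eqP sk.
  have -> : N%:R * (pi * x) = N%:R * v k + pi * k%:R by rewrite /v; field.
  suff H n : sin (n%:R * v k) = 0 by rewrite sinD H sin_natpi mul0r mulr0 addr0.
  elim: n => [|n IH]; first by rewrite mul0r sin0.
  by rewrite -natr1 mulrDl mul1r sinD IH sk mul0r mulr0 addr0.
have vn0 k : v k != 0 by apply: contra (sv k) => /eqP ->; rewrite sin0.
have vlt k : v k < pi.
  rewrite /v; have : 0 <= pi * (k%:R / N%:R) :> R by rewrite !mulr_ge0 ?invr_ge0// ltW.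
  have : pi * x < pi by rewrite gtr_pMr.
  by rewrite mulrBr; lra.
have vgt k : (k <= N)%N -> - pi < v k.
  move=> kN; rewrite /v mulrBr.
  have : pi * (k%:R / N%:R) <= pi :> R.
    by rewrite ger_pMr// ler_pdivrMr// mul1r ler_nat.
  have : 0 < pi * x by rewrite mulr_gt0.
  lra.
pose h w : R := w * (cos w / sin w).
pose h' w : R := cos w / sin w - w / sin w ^+ 2.
have tele : h (v 0%N) - h (v N) <= pi / N%:R * \sum_(k < N) h' (v k.+1).
  have -> : h (v 0%N) - h (v N) = \sum_(k < N) (h (v k) - h (v k.+1)).
    rewrite -(big_mkord xpredT (fun k => h (v k) - h (v k.+1))).
    under eq_bigr do rewrite -opprB.
    by rewrite sumrN telescope_sumr// opprB.
  rewrite mulr_sumr; apply: ler_sum => k _.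
  have -> : pi / N%:R = v k - v k.+1 by rewrite vS; ring.
  have dpos : 0 < pi / N%:R :> R by rewrite divr_gt0.
  apply: tangent_mul_cot => //; first exact: vgt.
    by rewrite vS; lra.
  rewrite vS; have : pi / N%:R <= pi :> R by rewrite ler_pdivrMr// ler_peMr ?ler1n// ltW.
  lra.
(* The points [v 0] and [v N] differ by pi, so their cotangents agree and h(v_0) - h(v_N) is pi
   times that cotangent. *)
have cotE : cos (v N) / sin (v N) = cos (v 0%N) / sin (v 0%N).
  by rewrite vNE v0E sinB cosB cospi sinpi; field; rewrite -v0E sv.
have {}tele : pi * (cos (v 0%N) / sin (v 0%N)) <= pi / N%:R * \sum_(k < N) h' (v k.+1).
  apply: le_trans tele; rewrite /h cotE vNE v0E; lra.
set Q := sin (N%:R * (pi * x)) ^+ 2.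
have Q0 : 0 <= Q by exact: sqr_ge0.
have DE k : Delta N (x - k%:R / N%:R) = Q / N%:R / sin (v k) ^+ 2.
  have := @Delta_closed R N (x - k%:R / N%:R) (ltn0Sn K).
  have -> : sin (N%:R * (pi * (x - k%:R / N%:R))) ^+ 2 = Q.
    have -> : N%:R * (pi * (x - k%:R / N%:R)) = N%:R * (pi * x) - pi * k%:R by field.
    rewrite sinB sin_natpi mulr0 subr0 exprMn cos2sin2 sin_natpi.
    by rewrite expr0n subr0 mulr1.
  (* Generalizing [pi] keeps [field] from unfolding it. *)
  by move=> <-; rewrite -/(v k); move: (pi : R) pn0 => p pn0; field;
    do ?[apply/andP; split]; first [exact: pn0|exact: N0n|exact: sv].
have D0E : Delta N x = Q / N%:R / sin (v 0%N) ^+ 2.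
  by rewrite -DE mul0r subr0.
have DN : Delta N (x - N%:R / N%:R) = Delta N x.
  by rewrite divff// -[LHS]Delta_periodic subrK.
(* The tangent points have indices 1 to N while the kernel identities use 0 to N - 1; periodicity
   identifies the two ends. *)
have shift (F : nat -> R) : F N = F 0%N -> \sum_(k < N) F k.+1 = \sum_(k < N) F k.
  by move=> FN; rewrite /N big_ord_recr/= -/N FN addrC big_ord_recl.
have sumD : \sum_(k < N) Delta N (x - k.+1%:R / N%:R) = N%:R.
  rewrite (shift (fun k => Delta N (x - k%:R / N%:R))) ?sum_Delta_shift//.
  by rewrite DN mul0r subr0.
have sumcot : 2 * Q * (\sum_(k < N) cos (v k.+1) / sin (v k.+1)) =
    N%:R * sin (2 * pi * N%:R * x).
  rewrite (shift (fun k => cos (v k) / sin (v k)))// /Q /v sum_cot//; last by move=> k _; exact: sv.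
  by congr (_ * sin _); ring.
(* The term Delta / (2 N) of [B] is the missing k = N term of the sum in [V]. Replacing the weight
   k/N - 1/2 by k/N - x then extracts exactly x - 1/2, because the shifted kernels sum to N. *)
have BE : B K x - (x - 1 / 2) =
   N%:R^-1 * (\sum_(k < N) (k.+1%:R / N%:R - x) * Delta N (x - k.+1%:R / N%:R))
   + (2 * pi * N%:R)^-1 * sin (2 * pi * N%:R * x)
   - (2 * pi)^-1 * Delta N x * sin (2 * pi * x).
  rewrite /B /V -/N.
  have -> : \sum_(k < N) (k.+1%:R / N%:R - x) * Delta N (x - k.+1%:R / N%:R) =
    \sum_(k < N) (k.+1%:R / N%:R - 1 / 2) * Delta N (x - k.+1%:R / N%:R) -
    (x - 1 / 2) * \sum_(k < N) Delta N (x - k.+1%:R / N%:R).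
    by rewrite mulr_sumr -sumrB; apply: eq_bigr => k _; ring.
  rewrite sumD {6}/N big_ord_recr/= -/N DN divff//.
  rewrite (big_addn 0 K.+1 1) subn1/= big_mkord.
  under [X in N%:R^-1 * X]eq_bigr do rewrite addn1.
  by move: (pi : R) pn0 => p pn0; field;
    do ?[apply/andP; split]; first [exact: pn0|exact: N0n|exact: sv].
rewrite -subr_ge0 BE.
have sin2 : sin (2 * pi * x) = 2 * sin (v 0%N) * cos (v 0%N).
  have -> : 2 * pi * x = v 0%N + v 0%N by rewrite v0E; ring.
  by rewrite sinD; ring.
have -> : sin (2 * pi * N%:R * x) = 2 * Q * (\sum_(k < N) cos (v k.+1) / sin (v k.+1)) / N%:R.
  by rewrite sumcot; field.
have -> : \sum_(k < N) (k.+1%:R / N%:R - x) * Delta N (x - k.+1%:R / N%:R) =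
  - (Q / N%:R / pi) * \sum_(k < N) v k.+1 / sin (v k.+1) ^+ 2.
  rewrite mulr_sumr; apply: eq_bigr => k _; rewrite DE.
  by rewrite {2}/v; move: (pi : R) pn0 => p pn0; field;
    do ?[apply/andP; split]; first [exact: pn0|exact: N0n|exact: sv].
rewrite D0E sin2.
have -> : - (Q / N%:R / pi) * (\sum_(k < N) v k.+1 / sin (v k.+1) ^+ 2) = 
   (Q / N%:R / pi) * (\sum_(k < N) h' (v k.+1)) - 
   (Q / N%:R / pi) * (\sum_(k < N) cos (v k.+1) / sin (v k.+1)).
  by rewrite /h' sumrB; ring.
set H := \sum_(k < N) h' _ in tele *; set C := \sum_(k < N) _.
(* The cotangent sums [C] cancel, leaving a nonnegative multiple of the telescoped tangent
   inequality. *)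
have -> : N%:R^-1 * (Q / N%:R / pi * H - Q / N%:R / pi * C) +
  (2 * pi * N%:R)^-1 * (2 * Q * C / N%:R) -
  (2 * pi)^-1 * (Q / N%:R / sin (v 0) ^+ 2) * (2 * sin (v 0) * cos (v 0)) =
  (Q / (N%:R * pi ^+ 2)) * (pi / N%:R * H - pi * (cos (v 0%N) / sin (v 0%N))).
  by move: (pi : R) pn0 => p pn0; field;
    do ?[apply/andP; split]; first [exact: pn0|exact: N0n|exact: sv].
apply: mulr_ge0; last by rewrite subr_ge0.
by rewrite divr_ge0// mulr_ge0 ?sqr_ge0 ?ltW.
Qed.

End Minorant.

(** * Minorization of [f], first at irrational points and then for the maxima *)

Section Minorization.
Variable R : realType.
Implicit Types (x y z : R) (K N k : nat) (A : {fset nat}).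

Lemma periodic_floor (g : R -> R) x : (forall y, g (y + 1) = g y) ->
  g (x - (Num.floor x)%:~R) = g x.
Proof.
move=> gp; have gn n y : g (y + n%:R) = g y.
  by elim: n => [|n IH]; rewrite ?addr0// -natr1 addrA gp.
case: (Num.floor x) => n; first by have := gn n (x - n%:R); rewrite subrK => <-.
by rewrite NegzE intrN opprK -pmulrn gn.
Qed.

Lemma rational_affine (s t : rat) x : t != 0 ->
  rational (ratr s + ratr t * x) -> rational x.
Proof.
move=> t0 [w _ wE]; exists ((w - s) / t) => //.
rewrite fmorph_div rmorphB/= wE; field.
by rewrite fmorph_eq0.
Qed.

Lemma sin_pi_irrational x : ~ rational x -> sin (pi * x) != 0.
Proof.
move=> irr; apply/eqP => s0; apply: irr.
pose t := x - (Num.floor x)%:~R.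
have /andP[t0 t1] : 0 <= t < 1.
  have := floor_itv x; rewrite intrD => /andP[]; rewrite /t; lra.
have st : sin (pi * t) ^+ 2 = 0.
  rewrite (@periodic_floor (fun y => sin (pi * y) ^+ 2)) ?s0 ?expr0n// => y.
  by rewrite mulrDr mulr1 sinDpi sqrrN.
case: (ltgtP t 0) t0 => // [t0 _|t0 _].
  have : 0 < sin (pi * t).
    by rewrite sin_gt0_pi// mulr_gt0 ?pi_gt0//= gtr_pMr ?pi_gt0.
  by move: st => /eqP; rewrite sqrf_eq0 => /eqP ->; rewrite ltxx.
exists (Num.floor x)%:~R => //; rewrite ratr_int.
by move: t0; rewrite /t => /eqP; rewrite subr_eq0 => /eqP.
Qed.

Lemma B_ge_sawtooth_irrational K x : (0 < K)%N -> 0 < x < 1 -> ~ rational x ->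
  x - 1 / 2 <= B K x.
Proof.
move=> K0 x01 irr; apply: B_ge_sawtooth_itv => //.
rewrite mulrCA; apply: sin_pi_irrational => /= rx; apply: irr.
apply: (@rational_affine 0 K.+1%:R); first by rewrite pnatr_eq0.
by rewrite rmorph0 add0r ratr_nat.
Qed.

(** On each of the three intervals cut out by 1/3 and 2/3, unit shifts where necessary bring both
    arguments of [B] into (0, 1). In the sum of the two sawtooth bounds t cancels, leaving minus the
    value of [f]. *)
Lemma selberg_le_f K x : (0 < K)%N -> ~ rational x -> selberg K x <= f x.
Proof.
move=> K0 irr; rewrite -(periodic_floor _ (@selberg_periodic R K)).
pose t := x - (Num.floor x)%:~R; rewrite /f -/t.
have irrt s c : c != 0 -> ~ rational (ratr s + ratr c * t).
  move=> c0 rt; apply: irr.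
  apply: (@rational_affine (s - c * (Num.floor x)%:~R) c) => //.
  move: rt; rewrite /t rmorphB rmorphM/= ratr_int; congr rational; ring.
have tneq (s : rat) : t != ratr s.
  apply/eqP => ts; apply: (@irrt 0 1); rewrite ?oner_neq0//.
  by rewrite rmorph0 rmorph1 add0r mul1r ts; exists s.
have tp (s : R) : (exists q : rat, s = ratr q) -> ~ rational (s + t).
  by move=> [q ->]; have := @irrt q 1 (oner_neq0 _); rewrite rmorph1 mul1r.
have tm (s : R) : (exists q : rat, s = ratr q) -> ~ rational (s - t).
  move=> [q ->]; have := @irrt q (-1); rewrite rmorphN rmorph1 mulN1r; apply.
  by rewrite oppr_eq0 oner_neq0.
have rfrac (i j : nat) : exists q : rat, i%:R / j%:R = ratr q :> R.
  by exists (i%:R / j%:R); rewrite fmorph_div/= !ratr_nat.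
have /andP[t0 t1] : 0 < t < 1.
  have := floor_itv x; rewrite intrD => /andP[h1 h2].
  have t0 : t != 0 by have := tneq 0; rewrite rmorph0.
  by rewrite lt_neqAle eq_sym t0 /t; lra.
have t3 : t != 1 / 3 by have [q ->] := rfrac 1%N 3%N; exact: tneq.
have t23 : t != 2 / 3 by have [q ->] := rfrac 2%N 3%N; exact: tneq.
have i1 : ~ rational (2 / 3 - t) by apply: tm; exact: rfrac.
have i2 : ~ rational (5 / 3 - t) by apply: tm; exact: rfrac.
have i3 : ~ rational (t - 1 / 3).
  rewrite addrC -mulNr; apply: tp; exists (- 1 / 3).
  by rewrite fmorph_div/= rmorphN rmorph1 ratr_nat.
have i4 : ~ rational (t + 2 / 3) by rewrite addrC; apply: tp; exact: rfrac.
have B1 : B K (2 / 3 - t) = B K (5 / 3 - t).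
  by rewrite -[LHS]B_periodic; congr B; lra.
have B2 : B K (t - 1 / 3) = B K (t + 2 / 3).
  by rewrite -[LHS]B_periodic; congr B; lra.
rewrite /selberg indicE; case: (ltgtP t (1 / 3)) t3 => // h1 _.
  rewrite memNset/=; last by rewrite in_itv/= leNgt h1.
  have := @B_ge_sawtooth_irrational K _ K0 _ i1.
  have := @B_ge_sawtooth_irrational K _ K0 _ i4.
  rewrite B2; move=> /(_ ltac:(lra)) ? /(_ ltac:(lra)); lra.
case: (ltgtP t (2 / 3)) t23 => // h2 _.
  rewrite mem_set/=; last by rewrite in_itv/= (ltW h1) h2.
  have := @B_ge_sawtooth_irrational K _ K0 _ i1.
  have := @B_ge_sawtooth_irrational K _ K0 _ i3.
  move=> /(_ ltac:(lra)) ? /(_ ltac:(lra)); lra.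
rewrite memNset/=; last by rewrite in_itv/= (ltW h1)/= ltNge (ltW h2).
have := @B_ge_sawtooth_irrational K _ K0 _ i2.
have := @B_ge_sawtooth_irrational K _ K0 _ i3.
rewrite B1; move=> /(_ ltac:(lra)) ? /(_ ltac:(lra)); lra.
Qed.

Lemma fsum_le_m A x : fsum A x <= m R A.
Proof. by have [y -> ] := mE R A. Qed.

(** A rational multiple q pi works, pi being irrational. The reduction to 0 <= x forces q to be
    nonzero. *)
Lemma exists_irrational_itv x y : x < y -> exists2 z, x < z < y & ~ rational z.
Proof.
wlog x0 : x y / 0 <= x => [H xy|xy].
  have [x0|x0] := leP 0 x; first exact: H.
  have [y0|y0] := leP y 0; last first.
    by have [z zxy irr] := H 0 y (lexx _) y0; exists z => //; lra.
  have [||z zxy irr] := H (- y) (- x); rewrite ?oppr_ge0 ?ltrN2//.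
  exists (- z); first lra.
  move=> rz; apply: irr; apply: (@rational_affine 0 (-1)) => //.
  by rewrite rmorph0 rmorphN rmorph1 add0r mulN1r.
have p0 := @pi_gt0 R.
have [q] : exists q : rat, x / pi < ratr q < y / pi.
  have /rat_in_itvoo[q] : x / pi < y / pi by rewrite ltr_pM2r ?invr_gt0.
  by rewrite in_itv/= => ?; exists q.
rewrite ltr_pdivrMr// ltr_pdivlMr// => qxy; exists (ratr q * pi) => //.
move=> rq; apply: (@pi_irrationnal R); apply: (@rational_affine 0 q).
  apply: contraTneq qxy => ->; rewrite rmorph0 mul0r; lra.
by rewrite rmorph0 add0r.
Qed.

(** If the bound failed at x, by continuity it would fail at a nearby irrational z. Every a z with a
    > 0 is then irrational, and [selberg_le_f] applies term by term. *)
Lemma selberg_sum_le_m K A x : (0 < K)%N -> (forall a, a \in A -> (0 < a)%N) ->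
  selberg_sum K A x <= m R A.
Proof.
move=> K0 A0; rewrite leNgt; apply/negP => mlt.
have := @selberg_sum_continuous R K A x.
move=> /(@cvgr_gt R^o R _ _ _ _) /(_ _ mlt) /nbhs_ballP[e /= e0 he].
have [z zx irr] := @exists_irrational_itv x (x + e) ltac:(lra).
have := he z; rewrite /= /ball/= => /(_ _)/wrap[].
  by rewrite ltr_norml; lra.
rewrite ltNge => /negP; apply; apply: le_trans (fsum_le_m A z).
rewrite /selberg_sum /fsum big_seq_cond [leRHS]big_seq_cond.
apply: ler_sum => a /andP[aA _]; apply: selberg_le_f => // ra; apply: irr.
apply: (@rational_affine 0 a%:R); first by rewrite pnatr_eq0 -lt0n A0.
by rewrite rmorph0 add0r ratr_nat.
Qed.

End Minorization.

(** * Lipschitz bounds for the Selberg polynomial *)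

Section SineLipschitz.
Variable R : realType.
Implicit Types (x y u v c : R) (F H : R -> R) (K N k n : nat).

Lemma abs_sin_nat_mul_le k x : `|sin (k%:R * x)| <= k%:R * `|sin x|.
Proof.
elim: k => [|k IH]; first by rewrite !mul0r sin0 normr0.
rewrite -natr1 !mulrDl !mul1r sinD (le_trans (ler_normD _ _))// !normrM lerD//.
  by apply: le_trans IH; rewrite ler_piMr// cos_max.
by rewrite ler_piMl// cos_max.
Qed.

(** The quantity |sin(pi (u - v))| is comparable to the distance of u and v modulo 1, and it is what
    [simultaneous_approximation] makes small. *)
Definition sin_lipschitz c F :=
  forall u v, `|F u - F v| <= c * `|sin (pi * (u - v))|.

Lemma sin_lipschitz_le c c' F : c <= c' -> sin_lipschitz c F -> sin_lipschitz c' F.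
Proof. by move=> cc' LF u v; apply: le_trans (LF u v) _; rewrite ler_wpM2r. Qed.

Lemma sin_lipschitzD c c' F H : sin_lipschitz c F -> sin_lipschitz c' H ->
  sin_lipschitz (c + c') (fun x => F x + H x).
Proof.
move=> LF LH u v; rewrite opprD addrACA mulrDl.
by apply: le_trans (ler_normD _ _) _; exact: lerD.
Qed.

Lemma sin_lipschitzN c F : sin_lipschitz c F -> sin_lipschitz c (fun x => - F x).
Proof. by move=> LF u v; rewrite -opprD normrN. Qed.

Lemma sin_lipschitzZ a c F : sin_lipschitz c F ->
  sin_lipschitz (`|a| * c) (fun x => a * F x).
Proof. by move=> LF u v; rewrite -mulrBr normrM -mulrA ler_wpM2l. Qed.

Lemma sin_lipschitz_sum (I : finType) (r : seq I) c (F : I -> R -> R) :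
  (forall i, sin_lipschitz c (F i)) ->
  sin_lipschitz (c *+ size r) (fun x => \sum_(i <- r) F i x).
Proof.
move=> LF; elim: r => [|i r IH] u v.
  by rewrite !big_nil subrr normr0 mulr0n mul0r.
rewrite !big_cons mulrS; exact: (sin_lipschitzD (LF i) IH).
Qed.

Lemma sin_lipschitzM c c' b b' F H : sin_lipschitz c F -> sin_lipschitz c' H ->
  (forall x, `|F x| <= b) -> (forall x, `|H x| <= b') -> 0 <= c ->
  sin_lipschitz (b * c' + c * b') (fun x => F x * H x).
Proof.
move=> LF LH Fb Hb c0 u v; set s := `|_|.
have -> : (b * c' + c * b') * `|sin (pi * (u - v))| =
  b * (c' * `|sin (pi * (u - v))|) + c * `|sin (pi * (u - v))| * b' by ring.
have -> : s = `|F u * (H u - H v) + (F u - F v) * H v|.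
  by rewrite /s; congr `|_|; ring.
rewrite (le_trans (ler_normD _ _))// !normrM lerD// ler_pM//.
Qed.

Lemma sin_lipschitz_shift c a F : sin_lipschitz c F ->
  sin_lipschitz c (fun x => F (x + a)).
Proof.
move=> LF u v; have := LF (u + a) (v + a).
by have -> : u + a - (v + a) = u - v by ring.
Qed.

Lemma sin_lipschitz_refl c a F : sin_lipschitz c F ->
  sin_lipschitz c (fun x => F (a - x)).
Proof.
move=> LF u v; have := LF (a - u) (a - v).
have -> : pi * (a - u - (a - v)) = - (pi * (u - v)) by ring.
by rewrite sinN normrN.
Qed.

Lemma cos_sub x y : cos x - cos y = - (2 * sin ((x + y) / 2) * sin ((x - y) / 2)).
Proof.
have hx : (x + y) / 2 + (x - y) / 2 = x by field.
have hy : (x + y) / 2 - (x - y) / 2 = y by field.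
have := cosD ((x + y) / 2) ((x - y) / 2); have := cosB ((x + y) / 2) ((x - y) / 2).
by rewrite hx hy => -> ->; ring.
Qed.

Lemma sin_lipschitz_cos k c : sin_lipschitz (2 * k%:R) (fun x => cos (2 * pi * (k%:R * x) + c)).
Proof.
move=> u v; rewrite cos_sub normrN !normrM ger0_norm// -!mulrA ler_wpM2l//.
have -> : (2 * (pi * (k%:R * u)) + c - (2 * (pi * (k%:R * v)) + c)) / 2 =
   k%:R * (pi * (u - v)) by field.
apply: le_trans (abs_sin_nat_mul_le _ _).
by rewrite ler_piMl// sin_max.
Qed.

Lemma sin_lipschitz_sin k : sin_lipschitz (2 * k%:R) (fun x => sin (2 * pi * k%:R * x)).
Proof.
move=> u v; have := @sin_lipschitz_cos k (- (pi / 2)) u v.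
by rewrite !cosBpihalf !mulrA.
Qed.

Lemma Delta_term_le1 N (j : nat) : (j <= 2 * N)%N ->
  `|1 - `|j%:Z - N%:Z|%:~R / N%:R : R| <= 1.
Proof.
move=> jN; have : (`|j%:Z - N%:Z| <= N%:Z)%R by lia.
rewrite -(ler_int R) -pmulrn => h.
have [->|N0] := posnP N; first by rewrite invr0 mulr0 subr0 normr1.
have N0R : (0 : R) < N%:R by rewrite ltr0n.
have : `|j%:Z - N%:Z|%:~R / N%:R <= 1 :> R by rewrite ler_pdivrMr// mul1r.
have : 0 <= `|j%:Z - N%:Z|%:~R / N%:R :> R by rewrite divr_ge0// ler0z.
by rewrite ler_norml; lra.
Qed.

Lemma Delta_abs_le N x : `|Delta N x| <= (2 * N%:R + 1 : R).
Proof.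
rewrite DeltaRe; apply: le_trans (ler_norm_sum _ _ _) _.
apply: (@le_trans _ _ (\sum_(j < (2 * N).+1) 1)).
  apply: ler_sum => j _; rewrite normrM -[leRHS]mulr1 ler_pM//.
    by apply: Delta_term_le1; rewrite -ltnS.
  exact: cos_max.
by rewrite sumr_const card_ord -addn1 natrD natrM.
Qed.

(** There are 2 N + 1 cosines, with coefficients at most 1 and frequencies at most N in absolute
    value; each contributes at most 2 N. *)
Lemma sin_lipschitz_Delta N :
  sin_lipschitz ((2 * N%:R + 1) * (2 * N%:R)) (@Delta R N).
Proof.
pose F (j : 'I_(2 * N).+1) x : R := (1 - `|j%:Z - N%:Z|%:~R / N%:R) *
    cos (2 * pi * ((j%:Z - N%:Z)%:~R * x)).
have LF j : sin_lipschitz (2 * N%:R) (F j).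
  pose k := `|j%:Z - N%:Z|%N.
  apply: (@sin_lipschitz_le (`|1 - `|j%:Z - N%:Z|%:~R / N%:R| * (2 * k%:R))).
    rewrite -[leRHS]mul1r ler_pM ?mulr_ge0//; first by apply: Delta_term_le1; rewrite -ltnS.
    rewrite ler_pM2l// ler_nat /k; have := ltn_ord j; lia.
  apply: sin_lipschitzZ => u v.
  have kE w : cos (2 * pi * ((j%:Z - N%:Z)%:~R * w)) = cos (2 * pi * (k%:R * w) + 0) :> R.
    rewrite addr0 /k natr_absz; have [z0|z0] := leP 0 (j%:Z - N%:Z).
      by rewrite ger0_norm.
    by rewrite ltr0_norm// intrN mulNr mulrN cosN.
  rewrite !kE; exact: sin_lipschitz_cos.
move=> u v; rewrite !DeltaRe.
have := sin_lipschitz_sum (index_enum 'I_(2 * N).+1) LF u v.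
have -> : size (index_enum 'I_(2 * N).+1) = (2 * N).+1.
  by rewrite -[RHS]card_ord cardE enumT.
have E : (2 * N).+1%:R = 2 * N%:R + 1 :> R by rewrite -addn1 natrD natrM.
have -> : 2 * N%:R *+ (2 * N).+1 = (2 * N%:R + 1) * (2 * N%:R) :> R.
  by rewrite -[LHS]mulr_natl E.
by [].
Qed.

Lemma pi_inv_le1 : (2 * pi)^-1 <= 1 :> R.
Proof. by rewrite invf_le1 ?mulr_gt0 ?pi_gt0//; have := @pi_ge2 R; lra. Qed.

Lemma sin_lipschitz_B K : (0 < K)%N -> sin_lipschitz (72 * K%:R ^+ 2) (@B R K).
Proof.
move=> K0; set N := K.+1.
have NK : N%:R = K%:R + 1 :> R by rewrite /N -natr1.
have K1 : 1 <= K%:R :> R by rewrite ler1n.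
have N0 : (0 : R) < N%:R by rewrite ltr0n.
have N1 : N%:R^-1 <= 1 :> R by rewrite invf_le1// ler1n.
set L := (2 * N%:R + 1) * (2 * N%:R) : R.
have L0 : 0 <= L by rewrite /L NK; nra.
have LD : sin_lipschitz L (@Delta R N) by exact: sin_lipschitz_Delta.
pose F (k : 'I_K) x : R := (k.+1%:R / N%:R - 1 / 2) * Delta N (x - k.+1%:R / N%:R).
have LF (k : 'I_K) : sin_lipschitz L (F k).
  apply: (@sin_lipschitz_le (`|k.+1%:R / N%:R - 1 / 2| * L)); last first.
    by apply: sin_lipschitzZ; exact: sin_lipschitz_shift.
  rewrite ler_piMl//.
  have : k.+1%:R / N%:R <= 1 :> R.
    by rewrite ler_pdivrMr// mul1r ler_nat; have := ltn_ord k; lia.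
  have : 0 <= k.+1%:R / N%:R :> R by rewrite divr_ge0.
  by rewrite ler_norml; lra.
have L1 : sin_lipschitz L (fun x => N%:R^-1 * \sum_(k < K) F k x).
  apply: (@sin_lipschitz_le (`|N%:R^-1| * (L *+ K))); last first.
    apply: sin_lipschitzZ => u v.
    have := sin_lipschitz_sum (index_enum 'I_K) LF u v.
    by have -> : size (index_enum 'I_K) = K by rewrite -[RHS]card_ord cardE enumT.
  rewrite ger0_norm ?invr_ge0// mulrC ler_pdivrMr// -[leLHS]mulr_natr ler_wpM2l//.
  by rewrite NK; lra.
have L2 : sin_lipschitz 2 (fun x => (2 * pi * N%:R)^-1 * sin (2 * pi * N%:R * x)).
  apply: (@sin_lipschitz_le (`|(2 * pi * N%:R)^-1| * (2 * N%:R))); last first.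
    exact/sin_lipschitzZ/sin_lipschitz_sin.
  rewrite ger0_norm; last by rewrite invr_ge0 !mulr_ge0 ?pi_ge0.
  have -> : (2 * pi * N%:R)^-1 * (2 * N%:R) = (2 * pi)^-1 * 2 :> R.
    have : (pi : R) != 0 by rewrite gt_eqF// pi_gt0.
    have : N%:R != 0 :> R by rewrite gt_eqF.
    by move: (pi : R) => p N0' p0; field; rewrite p0 N0'.
  by have := pi_inv_le1; lra.
have L3 : sin_lipschitz ((2 * N%:R + 1) * 2 + L * 1)
    (fun x => (2 * pi)^-1 * Delta N x * sin (2 * pi * x)).
  apply: sin_lipschitzM => //.
  - apply: (@sin_lipschitz_le (`|(2 * pi)^-1| * L)); last exact: sin_lipschitzZ.
    rewrite ger0_norm ?invr_ge0 ?mulr_ge0 ?pi_ge0// ler_piMl//; exact: pi_inv_le1.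
  - move=> u v; have := @sin_lipschitz_sin 1 u v; by rewrite !mulr1.
  - move=> x; rewrite normrM -[leRHS]mul1r ler_pM//; last exact: Delta_abs_le.
    rewrite ger0_norm ?invr_ge0 ?mulr_ge0 ?pi_ge0//; exact: pi_inv_le1.
  - move=> x; exact: sin_max.
have L4 : sin_lipschitz L (fun x => (2 * N%:R)^-1 * Delta N x).
  apply: (@sin_lipschitz_le (`|(2 * N%:R)^-1| * L)); last exact: sin_lipschitzZ.
  rewrite ger0_norm ?invr_ge0 ?mulr_ge0// ler_piMl// invf_le1 ?mulr_gt0//.
  by rewrite NK; lra.
have := sin_lipschitzD (sin_lipschitzD (sin_lipschitzD L1 L2) (sin_lipschitzN L3)) L4.
set F' := (X in sin_lipschitz _ X).
have -> : F' = @B R K.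
  apply/funext => x; rewrite /F' /B /V -/N; congr (_ * _ + _ - _ + _).
  rewrite (big_addn 0 K.+1 1) subn1/= big_mkord.
  by apply: eq_bigr => k _; rewrite addn1.
(* The constants add up to 3 L + 4 N + 4 = 12 N^2 + 10 N + 4, which for N = K + 1 is at most 72 K^2,
   with equality at K = 1. *)
by apply: sin_lipschitz_le; rewrite /L NK; nra.
Qed.

Lemma sin_lipschitz_selberg K : (0 < K)%N -> sin_lipschitz (144 * K%:R ^+ 2) (@selberg R K).
Proof.
move=> K0; have LB := sin_lipschitz_B K0.
have := sin_lipschitzD (sin_lipschitzN (sin_lipschitz_refl (2 / 3) LB))
  (sin_lipschitzN (sin_lipschitz_shift (- (1 / 3)) LB)).
apply: sin_lipschitz_le; lra.
Qed.

End SineLipschitz.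

(** * Small integer points of polyhedra, from vertices and Cramer's rule *)

Section SmallIntegerPoint.
Implicit Types (n p r M : nat).

(** Each of the n! terms of the Leibniz expansion is a product of n entries. *)
Lemma abs_det_le n M (A : 'M[int]_n) : (forall i j, `|A i j| <= M%:Z) ->
  `|\det A| <= (n`! * M ^ n)%N%:Z.
Proof.
move=> AM; apply: le_trans (ler_norm_sum _ _ _) _.
apply: (@le_trans _ _ (\sum_(s : 'S_n) (M ^ n)%N%:Z)).
  apply: ler_sum => s _; rewrite normrM normrX normrN1 expr1n mul1r normr_prod.
  rewrite [(M ^ n)%N%:Z](_ : _ = \prod_(i < n) M%:Z); last first.
    by rewrite prodr_const card_ord -[M%:Z]natz -natrX natz.
  by apply: ler_prod => i _; rewrite normr_ge0 AM.
by rewrite sumr_const card_Sn -[leLHS]mulr_natl natz PoszM.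
Qed.

Lemma abs_adj_le n M (A : 'M[int]_n.+1) i j : (forall i j, `|A i j| <= M%:Z) ->
  `|\adj A i j| <= (n`! * M ^ n)%N%:Z.
Proof.
move=> AM; rewrite mxE /cofactor normrM normrX normrN1 expr1n mul1r.
by apply: abs_det_le => k l; rewrite !mxE AM.
Qed.

Local Notation ratmx A := (map_mx (intr : int -> rat) A).

Lemma trivial_kernel_row_full (F : fieldType) p n (A : 'M[F]_(p, n)) :
  (forall w : 'cV_n, A *m w = 0 -> w = 0) -> row_full A.
Proof.
move=> kA; rewrite /row_full -mxrank_tr -/(row_free A^T) -kermx_eq0.
apply/eqP/row_matrixP => i; rewrite row0.
apply: trmx_inj; rewrite trmx0; apply: kA.
by apply: trmx_inj; rewrite trmx_mul trmxK trmx0 -row_mul mulmx_ker row0.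
Qed.

Section Vertex.
Variables (p r n : nat) (C : 'M[rat]_(p, n)) (L : 'M[rat]_(r, n)).
Hypothesis L_inj : forall w : 'cV_n, L *m w = 0 -> w = 0.

Let feasible (z : 'cV[rat]_n) := C *m z = 0 /\ forall i, 1 <= (L *m z) i 0.
Let tight (z : 'cV[rat]_n) := [set i | (L *m z) i 0 == 1].

(** Moving z along the line of direction w preserves the equations and the tight constraints.
    Injectivity of [L] makes some slack constraint vary, so the motion can go on until a new one
    becomes tight. *)
Lemma tight_extend (z w : 'cV[rat]_n) : feasible z -> C *m w = 0 ->
  (forall i, i \in tight z -> (L *m w) i 0 = 0) -> w != 0 ->
  exists2 z', feasible z' & (#|tight z| < #|tight z'|)%N.
Proof.
move=> [Cz Lz] Cw Lw w0.
wlog [i0 i0P] : w Cw Lw w0 / exists i, 0 < (L *m w) i 0 => [H|].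
  have [i Lwi] : exists i, (L *m w) i 0 != 0.
    apply/existsP; rewrite -[X in is_true X]negbK negb_exists.
    apply: contra w0 => /forallP h; apply/eqP/L_inj/colP => i; rewrite [RHS]mxE.
    by have := h i; rewrite negbK => /eqP.
  have [pos|neg] := ltP 0 ((L *m w) i 0); first by apply: (H w) => //; exists i.
  apply: (H (- w)); rewrite ?mulmxN ?Cw ?oppr0 ?oppr_eq0//.
    by move=> k kt; rewrite mxE Lw ?oppr0.
  by exists i; rewrite mxE oppr_gt0 lt_neqAle Lwi.
pose t i : rat := ((L *m z) i 0 - 1) / (L *m w) i 0.
(* Ratio test: along z - t w, constraint i becomes tight at time [t i]. The least such time among
   the decreasing constraints keeps all of them valid. *)
case: (@arg_minP _ _ _ i0 (fun i => 0 < (L *m w) i 0) t i0P) => k kP kmin.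
have Lz' i : (L *m (z - t k *: w)) i 0 = (L *m z) i 0 - t k * (L *m w) i 0.
  by rewrite mulmxBr -scalemxAr !mxE.
have tk0 : 0 <= t k by rewrite divr_ge0 ?subr_ge0// ltW.
exists (z - t k *: w).
  split; first by rewrite mulmxBr -scalemxAr Cz Cw scaler0 subr0.
  move=> i; rewrite Lz'; have [pos|neg] := ltP 0 ((L *m w) i 0).
    have := kmin i pos; rewrite /t ler_pdivlMr// -/(t k); lra.
  by have := Lz i; have := mulr_ge0_le0 tk0 neg; lra.
apply: proper_card; apply/fintype.properP; split.
  apply/fintype.subsetP => i it; rewrite inE Lz' Lw// mulr0 subr0.
  by move: it; rewrite inE.
exists k; last first.
  by apply: contraL kP => kt; rewrite Lw// ltxx.
rewrite inE Lz' /t; apply/eqP; rewrite divfK ?gt_eqF//; ring.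
Qed.

(** Iterating [tight_extend] stops, since at most r constraints can be tight. *)
Lemma vertex_exists (z : 'cV[rat]_n) : feasible z -> exists2 z', feasible z' &
  forall w : 'cV[rat]_n, C *m w = 0 -> (forall i, i \in tight z' -> (L *m w) i 0 = 0) -> w = 0.
Proof.
move: {2}(r - #|tight z|)%N (leqnn (r - #|tight z|)) => k.
elim: k z => [|k IH] z zk fz.
  exists z => // w Cw Lw; apply/eqP/negPn/negP => w0.
  have [z' _ zz'] := tight_extend fz Cw Lw w0.
  have := leq_trans zz' (max_card _); rewrite card_ord ltnNge.
  by rewrite -subn_eq0 -leqn0 zk.
have [[w [Cw Lw w0]]|nw] := pselect (exists w : 'cV[rat]_n, [/\ C *m w = 0,
    (forall i, i \in tight z -> (L *m w) i 0 = 0) & w != 0]).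
  have [z' fz' lt] := tight_extend fz Cw Lw w0.
  by apply: (IH z') => //; rewrite -ltnS (leq_trans _ zk)// ltn_sub2l// (leq_trans lt)//
    -[leqRHS](card_ord r) max_card.
exists z => // w Cw Lw; apply/eqP/negPn/negP => w0.
by apply: nw; exists w.
Qed.

End Vertex.

(* A vertex of the polyhedron [C y = 0, L y >= 1] solves a nonsingular subsystem
   with 0/1 right-hand side; clearing the determinant gives an integer point
   whose entries are combinations of cofactors. *)
Lemma small_integer_point p r n M (C : 'M[int]_(p, n.+1)) (L : 'M[int]_(r, n.+1))
    (y : 'cV[int]_n.+1) :
  (forall w : 'cV[rat]_n.+1, ratmx L *m w = 0 -> w = 0) ->
  (forall i j, `|C i j| <= M%:Z) -> (forall i j, `|L i j| <= M%:Z) ->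
  C *m y = 0 -> (forall i, 1 <= (L *m y) i 0) ->
  exists b : 'cV[int]_n.+1, [/\ C *m b = 0, forall i, 1 <= (L *m b) i 0 &
    forall j, `|b j 0| <= (n.+1 `! * M ^ n)%N%:Z].
Proof.
move=> Linj CM LM Cy Ly.
have [|z [Cz Lz] zvert] := @vertex_exists p r n.+1 (ratmx C) (ratmx L) Linj (ratmx y).
  split; first by rewrite -map_mxM Cy map_mx0.
  by move=> i; rewrite -map_mxM mxE ler1z.
pose tight i := (ratmx L *m z) i 0 == 1.
(* Slack rows are zeroed rather than removed, so the row index is unchanged; the vertex property
   says that [A] has trivial kernel. *)
pose Lt : 'M[int]_(r, n.+1) := \matrix_(i, j) if tight i then L i j else 0.
pose A := col_mx C Lt.
have LtE (w : 'cV[rat]_n.+1) i : (ratmx Lt *m w) i 0 = if tight i then (ratmx L *m w) i 0 else 0.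
  rewrite !mxE; case: ifP => ti; last by rewrite big1// => j _; rewrite !mxE ti mul0r.
  by apply: eq_bigr => j _; rewrite !mxE ti.
have full : row_full (ratmx A).
  apply: trivial_kernel_row_full => w; rewrite map_col_mx mul_col_mx.
  rewrite -[0]vsubmxK !linear0 => /eq_col_mx[Cw Lw]; apply: zvert => // i.
  rewrite inE => ti; have := LtE w i; rewrite Lw mxE /tight ti.
  by move/esym.
pose N := rowsub (fullrankfun full) A.
have Nunit : ratmx N \in unitmx.
  by have := fullrowsub_unit full; rewrite /N map_mxsub.
have NM i j : `|N i j| <= M%:Z.
  rewrite !mxE; case: splitP => k _; first exact: CM.
  by rewrite mxE; case: ifP; rewrite ?normr0.
have dN0 : \det N != 0.
  by move: Nunit; rewrite unitmxE det_map_mx unitfE intr_eq0.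
pose u : 'cV[int]_n.+1 :=
  rowsub (fullrankfun full) (col_mx 0 (\col_i (tight i : nat)%:Z)).
have Nz : ratmx N *m z = ratmx u.
  rewrite /N /u !map_mxsub mul_rowsub_mx; congr (mxsub _ _ _).
  rewrite !map_col_mx mul_col_mx Cz map_mx0; congr col_mx.
  apply/colP => i; rewrite LtE [RHS]mxE [X in _ = X%:~R]mxE.
  by case: ifP => // ti; rewrite (eqP ti).
(* By Cramer's rule [b] is |det N| times the vertex. The sign makes this factor positive, and being
   at least 1 it preserves the inequalities. *)
pose b : 'cV[int]_n.+1 := Num.sg (\det N) *: (\adj N *m u).
have bz : ratmx b = (`|\det N|%:~R : rat) *: z.
  rewrite /b map_mxZ/= map_mxM map_mx_adj -Nz mulmxA mul_adj_mx mul_scalar_mx.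
  by rewrite scalerA det_map_mx -intrM -normrEsg.
have d1 : (1 : rat) <= `|\det N|%:~R.
  by rewrite ler1z -gtz0_ge1 normr_gt0.
exists b; split.
- have Cb : ratmx (C *m b) = 0 by rewrite map_mxM bz -scalemxAr Cz scaler0.
  apply/colP => i; apply: (@intr_inj rat); have /colP/(_ i) := Cb.
  by rewrite [LHS]mxE => ->; rewrite !mxE.
- move=> i; rewrite -(ler1z rat).
  have -> : ((L *m b) i 0)%:~R = (ratmx L *m ratmx b) i 0.
    by rewrite -map_mxM [RHS]mxE.
  rewrite bz -scalemxAr mxE; have := Lz i; nra.
move=> j; rewrite mxE normrM normr_sg dN0 mul1r mxE.
(* An entry of [b] is, up to sign, a sum of at most n + 1 cofactors, each at most n! M^n in absolute
   value. *)
apply: le_trans (ler_norm_sum _ _ _) _.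
apply: (@le_trans _ _ (\sum_(k < n.+1) (n`! * M ^ n)%N%:Z)).
  apply: ler_sum => k _; rewrite normrM -[leRHS]mulr1 ler_pM//.
    exact: abs_adj_le.
  rewrite !mxE; case: splitP => l _; rewrite mxE ?normr0//.
  by case: (tight l).
by rewrite sumr_const card_ord -mulr_natl natz -PoszM mulnA -factS.
Qed.

End SmallIntegerPoint.

(** * Counting pairs of words with equal sums *)

Section Collisions.
Variables (W V : finType) (g : W -> V).

(** Cauchy-Schwarz for the fiber sizes of [g]: they add up to the size of [W], and their squares add
    up to the number of collisions. *)
Lemma collisions_ge :
  (#|W| ^ 2 <= #|V| * \sum_(x : W) \sum_(y : W) (g x == g y))%N.
Proof.
pose N v := (\sum_(x : W) (g x == v))%N.
have NE : (\sum_v N v = #|W|)%N.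
  rewrite exchange_big/= -sum1_card; apply: eq_bigr => x _.
  by rewrite (bigD1 (g x))//= eqxx big1 ?addn0// => v vx; rewrite eq_sym (negbTE vx).
have N2E : (\sum_v N v ^ 2 = \sum_(x : W) \sum_(y : W) (g x == g y))%N.
  under eq_bigr do rewrite -mulnn big_distrlr/=.
  rewrite exchange_big/=; apply: eq_bigr => x _; rewrite exchange_big/=.
  apply: eq_bigr => y _; rewrite (bigD1 (g x))//= eqxx mul1n.
  rewrite [g y == g x]eq_sym big1 ?addn0// => v vx.
  by rewrite [g x == v]eq_sym (negbTE vx) mul0n.
rewrite -N2E -(leq_pmul2l (ltn0Sn 1)) -NE -mulnn big_distrlr/= big_distrr/=.
apply: (@leq_trans (\sum_u \sum_v (N u ^ 2 + N v ^ 2))).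
  apply: leq_sum => u _; rewrite big_distrr/=; apply: leq_sum => v _.
  exact: nat_Cauchy.
under eq_bigr do rewrite big_split/= sum_nat_const.
by rewrite big_split/= sum_nat_const -big_distrr/= addnn mul2n.
Qed.

End Collisions.

(** The letter [None] stands for the summand 0; it supplies the fixed phase 0 with which the other
    phases are compared. *)
Local Notation word n q := {ffun 'I_q -> option 'I_n}.

Section Words.
Variables (n q : nat).
Implicit Types (a : 'I_n -> nat).

Definition letter_count (phi : word n q) (i : 'I_n) : nat := (\sum_(t < q) (phi t == Some i))%N.

Definition word_sum a (phi : word n q) : nat := (\sum_(t < q) oapp a 0%N (phi t))%N.

Lemma letter_count_le phi i : (letter_count phi i <= q)%N.
Proof.
rewrite -[leqRHS]card_ord -sum1_card; apply: leq_sum => t _; exact: leq_b1.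
Qed.

Lemma word_sumE a phi : word_sum a phi = (\sum_i a i * letter_count phi i)%N.
Proof.
under [RHS]eq_bigr do rewrite big_distrr/=.
rewrite exchange_big/=; apply: eq_bigr => t _; case: (phi t) => [i|]/=; last first.
  by rewrite big1// => i _; rewrite muln0.
rewrite (bigD1 i)//= eqxx muln1 big1 ?addn0// => j ji.
by rewrite (inj_eq Some_inj) eq_sym (negbTE ji) muln0.
Qed.

(** The sum of a word depends only on its letter counts, a vector with at most (q + 1)^n values. *)
Lemma word_collisions_ge a :
  (n.+1 ^ (2 * q) <= q.+1 ^ n *
    \sum_(phi : word n q) \sum_(psi : word n q) (word_sum a phi == word_sum a psi))%N.
Proof.
pose vec (phi : word n q) : {ffun 'I_n -> 'I_q.+1} := [ffun i => inord (letter_count phi i)].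
have := collisions_ge vec.
rewrite !card_ffun card_option !card_ord -expnM mulnC => /leq_trans; apply.
rewrite leq_mul2l; apply/orP; right.
apply: leq_sum => phi _; apply: leq_sum => psi _; case: eqP => // vE.
suff -> : word_sum a phi = word_sum a psi by rewrite eqxx.
rewrite !word_sumE; apply: eq_bigr => i _; congr (_ * _)%N.
move: vE => /ffunP/(_ i); rewrite !ffunE => /(congr1 val)/=.
by rewrite !inordK// ltnS letter_count_le.
Qed.

End Words.

(** * Simultaneous approximation from high moments of exponential sums *)

Section Kronecker.
Variable R : realType.
Local Open Scope complex_scope.

Lemma eD (x y : R) : e (x + y) = e x * e y.
Proof.
rewrite /e !mulrDr cosD sinD; apply/eqP; rewrite eq_complex/=.
by apply/andP; split; apply/eqP; ring.
Qed.

Lemma e_sum (I : finType) (F : I -> R) : e (\sum_i F i) = \prod_i e (F i).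
Proof.
apply: (big_morph _ eD).
by rewrite /e mulr0 cos0 sin0.
Qed.

Definition sqnorm_sum_e (I : finType) (th : I -> R) : R :=
  (\sum_i cos (2 * pi * th i)) ^+ 2 + (\sum_i sin (2 * pi * th i)) ^+ 2.

Lemma sqnorm_sum_eE (I : finType) (th : I -> R) :
  (sqnorm_sum_e th)%:C = (\sum_i e (th i)) * (\sum_i e (- th i)).
Proof.
have sumE (F : I -> R[i]) : \sum_i F i =
    (\sum_i complex.Re (F i)) +i* (\sum_i complex.Im (F i)).
  by rewrite -Re_sum -Im_sum; case: (\sum_i _).
rewrite !sumE/=.
under [X in _ * (X +i* _)]eq_bigr do rewrite mulrN cosN.
under [X in _ * (_ +i* X)]eq_bigr do rewrite mulrN sinN.
rewrite sumrN /sqnorm_sum_e; apply/eqP; rewrite eq_complex/=.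
by apply/andP; split; apply/eqP; ring.
Qed.

Lemma sqnorm_sum_e_exp (I : finType) (th : I -> R) q :
  sqnorm_sum_e th ^+ q = \sum_(phi : {ffun 'I_q -> I}) \sum_(psi : {ffun 'I_q -> I})
     cos (2 * pi * (\sum_t th (phi t) - \sum_t th (psi t))).
Proof.
have key F : (\sum_i e (F i)) ^+ q = \sum_(phi : {ffun 'I_q -> I}) e (\sum_t F (phi t)) :> R[i].
  under [RHS]eq_bigr do rewrite e_sum.
  by rewrite -(bigA_distr_bigA (fun _ i => e (F i))) prodr_const card_ord.
have -> : sqnorm_sum_e th ^+ q = complex.Re ((sqnorm_sum_e th)%:C ^+ q).
  by rewrite -rmorphXn.
rewrite sqnorm_sum_eE exprMn !key big_distrlr/= Re_sum; apply: eq_bigr => phi _.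
rewrite Re_sum; apply: eq_bigr => psi _.
by rewrite sumrN -eD.
Qed.

(** The right-hand side is the sum of 1 - cos(2 pi (th k - th l)) over all pairs, and no term is
    negative. Thus a nearly maximal modulus forces all phases to be close. *)
Lemma sqnorm_sum_e_deficit (I : finType) (th : I -> R) (i j : I) :
  1 - cos (2 * pi * (th i - th j)) <= #|I|%:R ^+ 2 - sqnorm_sum_e th.
Proof.
have -> : sqnorm_sum_e th = \sum_k \sum_l cos (2 * pi * (th k - th l)).
  rewrite /sqnorm_sum_e !expr2 !big_distrlr/= -big_split; apply: eq_bigr => k _ /=.
  by rewrite -big_split; apply: eq_bigr => l _ /=; rewrite mulrBr cosB.
have -> : #|I|%:R ^+ 2 = \sum_(k : I) \sum_(l : I) 1 :> R.
  rewrite !sumr_const expr2 -[RHS]mulr_natr.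
  by congr (_%:R * _%:R); apply: eq_card => k; rewrite !inE.
rewrite -sumrB; have c1 k l : 0 <= 1 - cos (2 * pi * (th k - th l)).
  by rewrite subr_ge0 cos_le1.
rewrite (bigD1 i)//= -sumrB (bigD1 j)//= -addrA lerDl addr_ge0 ?sumr_ge0//.
by move=> k _; rewrite -sumrB sumr_ge0.
Qed.

(** Discrete form of orthogonality over a period: M equally spaced points suffice because |s - t| <
    M. *)
Lemma sum_cos_average (s t M : nat) (c : R) : (s < M)%N -> (t < M)%N ->
  \sum_(j < M) cos (2 * pi * ((s%:R - t%:R) * (j%:R / M%:R) - c)) =
  M%:R * (s == t)%:R * cos (2 * pi * c).
Proof.
move=> sM tM; case: (ltngtP s t) => [st|ts|->]; last first.
- under eq_bigr do rewrite subrr mul0r sub0r mulrN cosN.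
  by rewrite sumr_const card_ord mulr1 -[LHS]mulr_natl.
- rewrite mulr0 mul0r -[RHS](@sum_cos_equidistributed R M (s - t) (2 * pi * c)).
    apply: eq_bigr => j _; rewrite -cosN natrB; last exact: ltnW.
    by congr cos; ring.
  by rewrite subn_gt0 ts (leq_ltn_trans _ sM)// leq_subr.
- rewrite mulr0 mul0r -[RHS](@sum_cos_equidistributed R M (t - s) (- (2 * pi * c))).
    apply: eq_bigr => j _; rewrite natrB; last exact: ltnW.
    by congr cos; ring.
  by rewrite subn_gt0 st (leq_ltn_trans _ tM)// leq_subr.
Qed.

(* On average over the multiples of [1 / M], only the pairs of words with equal
   [a]-sums contribute, and for those the phases coming from [a'] cancel. *)
Lemma exists_large_sqnorm n q (a a' : 'I_n -> nat) (x0 : R) :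
  (forall phi psi : word n q, word_sum a phi = word_sum a psi ->
     word_sum a' phi = word_sum a' psi) ->
  exists x : R, n.+1%:R ^+ (2 * q) <= q.+1%:R ^+ n *
    sqnorm_sum_e (oapp (fun i => (a i)%:R * x - (a' i)%:R * x0) 0) ^+ q.
Proof.
move=> rel; pose th (x : R) : option 'I_n -> R := oapp (fun i => (a i)%:R * x - (a' i)%:R * x0) 0.
(* Any modulus exceeding every word sum would do; it allows [sum_cos_average] to be applied to all
   pairs. *)
pose M := (\sum_(phi : word n q) word_sum a phi)%N.+1.
have aM (phi : word n q) : (word_sum a phi < M)%N.
  by rewrite /M ltnS (bigD1 phi)//= leq_addr.
pose E := (\sum_(phi : word n q) \sum_(psi : word n q) (word_sum a phi == word_sum a psi))%N.
have thE x (phi : word n q) :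
    \sum_t th x (phi t) = (word_sum a phi)%:R * x - (word_sum a' phi)%:R * x0.
  rewrite /word_sum !natr_sum !mulr_suml -sumrB; apply: eq_bigr => t _.
  by rewrite /th; case: (phi t) => [i|]/=; rewrite ?mul0r ?subr0.
have avg : \sum_(j < M) sqnorm_sum_e (th (j%:R / M%:R)) ^+ q = M%:R * E%:R.
  under eq_bigr do rewrite sqnorm_sum_e_exp.
  rewrite exchange_big /E natr_sum mulr_sumr; apply: eq_bigr => phi _ /=.
  rewrite exchange_big natr_sum mulr_sumr; apply: eq_bigr => psi _ /=.
  transitivity (\sum_(j < M) cos (2 * pi * (((word_sum a phi)%:R - (word_sum a psi)%:R)
     * (j%:R / M%:R) - ((word_sum a' phi)%:R - (word_sum a' psi)%:R) * x0))).
    by apply: eq_bigr => j _; rewrite !thE; congr cos; ring.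
  rewrite sum_cos_average//; have [/rel ->|_] := eqVneq; last by rewrite mulr0 mul0r.
  by rewrite subrr mul0r mulr0 cos0 !mulr1.
have [j Ej] : exists j : 'I_M, E%:R <= sqnorm_sum_e (th (j%:R / M%:R)) ^+ q.
  apply: contrapT => /forallNP no.
  have : \sum_(j < M) sqnorm_sum_e (th (j%:R / M%:R)) ^+ q < \sum_(j < M) E%:R.
    apply: ltr_sum => [|j _]; last by rewrite ltNge; apply/negP/no.
    by apply/hasP; exists ord0; rewrite ?mem_index_enum.
  by rewrite avg sumr_const card_ord mulr_natl ltxx.
exists (j%:R / M%:R); apply: (@le_trans _ _ (q.+1%:R ^+ n * E%:R)).
  by rewrite -!natrX -natrM ler_nat word_collisions_ge.
by rewrite ler_wpM2l ?exprn_ge0.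
Qed.

(** With q = r^2 and r = 2 n h + 1, the factors are at most exp(- r^2 / h) and (1 + r)^(2 n) <=
    exp(2 r n); the first wins because r / h > 2 n. *)
Lemma exp_lt_polynomial (n h q : nat) : (0 < h)%N ->
  q = ((2 * n * h).+1 ^ 2)%N ->
  (1 - h%:R^-1) ^+ q * q.+1%:R ^+ n < 1 :> R.
Proof.
move=> h0; set r := (2 * n * h).+1 => qE.
have h0R : (0 : R) < h%:R by rewrite ltr0n.
have h1 : h%:R^-1 <= 1 :> R by rewrite invf_le1// ler1n.
have i1 : (1 - h%:R^-1) ^+ q <= expR (- (h%:R^-1 * q%:R)) :> R.
  rewrite -mulNr expRM_natr lerXn2r ?nnegrE ?expR_ge0 ?subr_ge0//.
  exact: expR_ge1Dx.
have i2 : q.+1%:R ^+ n <= expR (2 * r%:R * n%:R) :> R.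
  rewrite expRM_natr lerXn2r ?nnegrE ?expR_ge0//.
  apply: (@le_trans _ _ ((1 + r%:R) ^+ 2)).
    have -> : q.+1%:R = r%:R ^+ 2 + 1 :> R by rewrite -natr1 qE natrX.
    by have : (0 : R) <= r%:R by []; nra.
  rewrite mulrC expRM_natr lerXn2r ?nnegrE ?expR_ge0 ?addr_ge0//.
  exact: expR_ge1Dx.
apply: le_lt_trans (_ : _ <= expR (- (h%:R^-1 * q%:R)) * expR (2 * r%:R * n%:R)) _.
  by rewrite ler_pM ?exprn_ge0// subr_ge0.
rewrite -expRD expR_lt1 addrC subr_lt0.
have -> : h%:R^-1 * q%:R = r%:R * (r%:R / h%:R) :> R.
  by rewrite qE natrX; field; rewrite gt_eqF.
have r0 : (0 : R) < r%:R by rewrite ltr0n.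
rewrite [ltLHS](_ : _ = r%:R * (2 * n%:R)); last by ring.
rewrite ltr_pM2l// ltr_pdivlMr// -!natrM ltr_nat /r.
by rewrite ltnS.
Qed.

(** A squared modulus below (n + 1)^2 (1 - 1 / g^2) would contradict [exists_large_sqnorm], by
    [exp_lt_polynomial] with h = g^2. The deficit is thus at most ((n + 1) / g)^2, and comparing a
    letter with [None] bounds 1 - cos(2 pi z) = 2 sin^2(pi z). *)
Lemma simultaneous_approximation n (g : nat) (a a' : 'I_n -> nat) (x0 : R) :
  (0 < g)%N ->
  let q := ((2 * n * g ^ 2).+1 ^ 2)%N in
  (forall phi psi : word n q, word_sum a phi = word_sum a psi ->
     word_sum a' phi = word_sum a' psi) ->
  exists x : R, forall i, `|sin (pi * ((a i)%:R * x - (a' i)%:R * x0))| <= n.+1%:R / g%:R.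
Proof.
move=> g0 q rel; have [x xP] := exists_large_sqnorm x0 rel.
exists x => i; set th := oapp _ _ in xP.
have h0 : (0 < g ^ 2)%N by rewrite expn_gt0 g0.
have h0R : (0 : R) < (g ^ 2)%N%:R by rewrite ltr0n.
set P := sqnorm_sum_e th in xP.
have P0 : 0 <= P by rewrite addr_ge0 ?sqr_ge0.
have n0 : (0 : R) < n.+1%:R ^+ 2 by rewrite exprn_gt0.
have Pge : n.+1%:R ^+ 2 * (1 - (g ^ 2)%N%:R^-1) <= P.
  rewrite leNgt; apply/negP => Plt.
  have Pq : P ^+ q <= (n.+1%:R ^+ 2 * (1 - (g ^ 2)%N%:R^-1)) ^+ q.
    by apply: lerXn2r; rewrite ?nnegrE // ?(le_trans P0 (ltW Plt))// ltW.
  have := @exp_lt_polynomial n _ q h0 erefl; apply/negP.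
  rewrite -leNgt -(ler_pM2l (exprn_gt0 q n0)) mulr1 -exprM.
  apply: le_trans xP _; rewrite mulrC.
  by apply: le_trans (ler_wpM2r (exprn_ge0 _ _) Pq) _; rewrite ?ler0n// exprMn -mulrA exprM.
have := sqnorm_sum_e_deficit th (Some i) None; rewrite /th/= subr0 -/th -/P.
rewrite card_option card_ord => def.
set z := (a i)%:R * x - _ in def *.
have cE : cos (2 * pi * z) = 1 - 2 * sin (pi * z) ^+ 2.
  have -> : 2 * pi * z = pi * z + pi * z by ring.
  rewrite cosD -!expr2 cos2sin2; ring.
have sq : sin (pi * z) ^+ 2 <= (n.+1%:R / g%:R) ^+ 2.
  have gE : (g ^ 2)%N%:R^-1 = g%:R^-1 ^+ 2 :> R by rewrite natrX exprVn.
  rewrite exprMn -gE; have := sqr_ge0 (sin (pi * z)).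
  rewrite mulrBr mulr1 in Pge; rewrite cE in def; lra.
by rewrite -(@ler_pXn2r _ 2%N)// ?nnegrE ?divr_ge0// real_normK ?num_real.
Qed.

End Kronecker.

(** * A small set satisfying the same short relations *)

Section SmallModel.
Variables (n q : nat) (a : 'I_n.+1 -> nat).
Local Notation wordpair := ({ffun 'I_q -> option 'I_n.+1} * {ffun 'I_q -> option 'I_n.+1})%type.

Let relation_mx : 'M[int]_(#|{: wordpair}|, n.+1) := \matrix_(k, j)
  let: (phi, psi) := enum_val k in
  if word_sum a phi == word_sum a psi
  then (letter_count phi j)%:Z - (letter_count psi j)%:Z else 0.

(* Row [(i, None)] is the constraint [1 <= y_i]; row [(i, Some j)] is
   [y_j + 1 <= y_i] when [a j < a i]. *)
Let order_mx : 'M[int]_(#|{: 'I_n.+1 * option 'I_n.+1}|, n.+1) := \matrix_(k, l)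
  let: (i, o) := enum_val k in
  (i == l : nat)%:Z - (if o is Some j then ((a j < a i) && (j == l))%N : nat else 0%N)%:Z.

Let order_mxE (T : pzRingType) (y : 'cV[T]_n.+1) i o :
  (map_mx intr order_mx *m y) (enum_rank (i, o)) 0 =
  y i 0 - (if o is Some j then if (a j < a i)%N then y j 0 else 0 else 0).
Proof.
rewrite mxE; under eq_bigr => l _ do rewrite !mxE enum_rankK intrB mulrBl.
rewrite sumrB; congr (_ - _).
  rewrite (bigD1 i)//= eqxx mul1r big1 ?addr0// => l li.
  by rewrite eq_sym (negbTE li) mul0r.
case: o => [j|]; last by rewrite big1// => l _; rewrite mul0r.
case: ltnP => _; last by rewrite big1// => l _; rewrite mul0r.
rewrite (bigD1 j)//= eqxx mul1r big1 ?addr0// => l lj.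
by rewrite eq_sym (negbTE lj) mul0r.
Qed.

(** The vector of the [a i] is itself feasible for [small_integer_point] with M = q: relation
    coefficients are differences of letter counts, order coefficients are at most 1 in absolute
    value. The order rows give positivity and injectivity of [a']. *)
Lemma small_model : (0 < q)%N -> injective a -> (forall i, (0 < a i)%N) ->
  exists a' : 'I_n.+1 -> nat, [/\ injective a',
    forall i, (0 < a' i <= n.+1`! * q ^ n)%N &
    forall phi psi : {ffun 'I_q -> option 'I_n.+1},
      word_sum a phi = word_sum a psi -> word_sum a' phi = word_sum a' psi].
Proof.
move=> q0 ainj apos; pose y : 'cV[int]_n.+1 := \col_i (a i)%:Z.
have intmx (p : nat) (M : 'M[int]_(p, n.+1)) : map_mx intr M = M.
  by apply/matrixP => i j; rewrite mxE intz.
have relE (b : 'cV[int]_n.+1) phi psi : word_sum a phi = word_sum a psi ->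
    (relation_mx *m b) (enum_rank (phi, psi)) 0 =
    \sum_j (letter_count phi j)%:Z * b j 0 - \sum_j (letter_count psi j)%:Z * b j 0.
  move=> eqs; rewrite mxE -sumrB; apply: eq_bigr => j _.
  by rewrite mxE enum_rankK eqs eqxx mulrBl.
have wsE (c : 'I_n.+1 -> nat) (phi : {ffun 'I_q -> option 'I_n.+1}) :
    (word_sum c phi)%:Z = \sum_j (letter_count phi j)%:Z * (c j)%:Z.
  rewrite word_sumE -[LHS]natz natr_sum; apply: eq_bigr => j _.
  by rewrite natz mulnC PoszM.
have [|||||b [Cb Lb bM]] := @small_integer_point _ _ n q relation_mx order_mx y.
- move=> w Lw; apply/colP => i; rewrite [RHS]mxE.
  by have := order_mxE w i None; rewrite Lw mxE subr0 => <-.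
- move=> k j; rewrite mxE; case: (enum_val k) => phi psi; case: ifP => _; last by rewrite normr0.
  have := letter_count_le phi j; have := letter_count_le psi j; lia.
- move=> k j; rewrite mxE; case: (enum_val k) => i [l|]; last by case: (i == j); lia.
  by case: (i == j); case: (_ && _); lia.
- apply/colP => k; rewrite [RHS]mxE -[k]enum_valK; case: (enum_val k) => phi psi.
  have [eqs|neqs] := eqVneq (word_sum a phi) (word_sum a psi).
    rewrite relE//.
    under eq_bigr do rewrite mxE; under [X in _ - X]eq_bigr do rewrite mxE.
    by rewrite -!wsE eqs subrr.
  by rewrite mxE big1// => j _; rewrite mxE enum_rankK (negbTE neqs) mul0r.
- move=> k; rewrite -[k]enum_valK; case: (enum_val k) => i o.
  rewrite -[order_mx]intmx order_mxE mxE.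
  have ai := apos i; case: o => [j|]; last by lia.
  by case: ltnP => ji; rewrite ?mxE; lia.
have bo i o : 1 <= b i 0 - (if o is Some j then if (a j < a i)%N then b j 0 else 0 else 0).
  by rewrite -order_mxE intmx.
have b1 i : 1 <= b i 0 by have := bo i None; rewrite subr0.
have bE i : (absz (b i 0))%:Z = b i 0 by have := b1 i; lia.
exists (fun i => absz (b i 0)); split.
- move=> i j /(congr1 Posz); rewrite !bE => bij.
  case: (ltngtP (a i) (a j)) => [aij|aji|/ainj//].
    by have := bo j (Some i); rewrite aij; lia.
  by have := bo i (Some j); rewrite aji; lia.
- by move=> i; have := b1 i; have := bM i; lia.
move=> phi psi eqs; apply/eqP; rewrite -eqz_nat -subr_eq0 !wsE.
have absE (chi : {ffun 'I_q -> option 'I_n.+1}) :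
    \sum_j (letter_count chi j)%:Z * (absz (b j 0))%:Z = \sum_j (letter_count chi j)%:Z * b j 0.
  by apply: eq_bigr => j _; rewrite bE.
by rewrite !absE -relE// Cb mxE.
Qed.

End SmallModel.

(** * Transfer from small sets to arbitrary sets, and choice of constants *)

Section Transfer.
Variable R : realType.
Implicit Types (A : {fset nat}) (K n D : nat).

(** Here 144 K^2 is the Lipschitz constant of [selberg K]; the other factors make n errors of size
    144 K^2 (n + 1) / g add up to exactly 1 / D. *)
Definition approx_scale K n D := (144 * K ^ 2 * (n * n.+1) * D)%N.

Definition word_length K n D := ((2 * n * approx_scale K n D ^ 2).+1 ^ 2)%N.

Lemma big_fset_nth A (F : nat -> R) :
  \sum_(x <- A) F x = \sum_(i < #|` A|) F (nth 0%N A i).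
Proof. by rewrite (big_nth 0%N) big_mkord. Qed.

(** The bound on the elements of [A'] is independent of those of [A]; this reduces arbitrary sets to
    sets in [1, T]. *)
Lemma exists_small_set K n D A (delta : R) :
  (0 < K)%N -> (0 < D)%N -> D%:R^-1 <= delta ->
  #|` A| = n.+1 -> (forall x, x \in A -> (0 < x)%N) ->
  exists A' : {fset nat}, [/\ #|` A'| = n.+1,
    forall x, x \in A' -> (0 < x <= n.+1`! * word_length K n.+1 D ^ n)%N &
    forall x0 : R, exists x, selberg_sum K A' x0 - delta <= selberg_sum K A x].
Proof.
move=> K0 D0 Ddelta cA A0; set q := word_length K n.+1 D.
pose a (i : 'I_n.+1) := nth 0%N A i.
have szA : size A = n.+1 by [].
have ainj : injective a.
  move=> i j /eqP; rewrite nth_uniq ?szA ?fset_uniq// => /eqP; exact: val_inj.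
have apos i : (0 < a i)%N by apply: A0; rewrite mem_nth ?szA.
have [|a' [a'inj a'b rel]] := @small_model n q a _ ainj apos; first by rewrite expn_gt0.
pose s := [seq a' i | i <- enum 'I_n.+1].
have us : uniq s by rewrite map_inj_uniq ?enum_uniq.
pose A' := seq_fset tt s.
have perm : perm_eq A' s by rewrite -[X in perm_eq _ X](undup_id us) seq_fset_perm.
exists A'; split.
- by rewrite size_seq_fset undup_id// size_map size_enum_ord.
- by move=> x; rewrite seq_fsetE => /mapP[i _ ->].
move=> y0; pose g := approx_scale K n.+1 D.
have g0 : (0 < g)%N by rewrite /g /approx_scale !muln_gt0 K0 D0.
have [x xP] := @simultaneous_approximation R n.+1 g a a' y0 g0 rel.
exists x; rewrite lerBlDl -lerBlDr.
rewrite /selberg_sum (perm_big _ perm)/= big_map enumT big_fset_nth cA.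
rewrite -sumrB; apply: le_trans Ddelta.
apply: (@le_trans _ _ (\sum_(i < n.+1) 144 * K%:R ^+ 2 * (n.+2%:R / g%:R))).
  apply: ler_sum => i _; apply: le_trans (ler_norm _) _; rewrite distrC.
  apply: le_trans (sin_lipschitz_selberg K0 _ _) _.
  by rewrite ler_wpM2l ?mulr_ge0 ?exprn_ge0 ?xP.
rewrite sumr_const card_ord -[leLHS]mulr_natl.
rewrite /g /approx_scale !natrM le_eqVlt; apply/orP; left; apply/eqP.
by field; apply/and4P; split; rewrite gt_eqF ?ltr0n// ltr_wpDr.
Qed.

End Transfer.

(** Both n and K are bounded by X = n K, and n + 1 by 2 X. The scale is then at most 288 D X^4, and
    the square root of the word length at most 3 (288 D)^2 X^9. *)
Lemma word_length_le K n D : (0 < n)%N -> (0 < K)%N -> (0 < D)%N ->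
  (n * word_length K n D <= 9 * (288 * D) ^ 4 * (n * K) ^ 19)%N.
Proof.
move=> n0 K0 D0; set X := (n * K)%N.
have nX : (n <= X)%N by rewrite leq_pmulr.
have KX : (K <= X)%N by rewrite leq_pmull.
have X0 : (0 < X)%N by rewrite muln_gt0 n0.
have gX : (approx_scale K n D <= 288 * D * X ^ 4)%N.
  have -> : (288 * D * X ^ 4 = 144 * X ^ 2 * (X * (2 * X)) * D)%N by ring.
  rewrite leq_mul// leq_mul//; first by rewrite leq_mul// leq_sqr.
  by rewrite leq_mul//; lia.
have rX : ((2 * n * approx_scale K n D ^ 2).+1 <= 3 * (288 * D) ^ 2 * X ^ 9)%N.
  have : (n * approx_scale K n D ^ 2 <= X * (288 * D * X ^ 4) ^ 2)%N.
    by rewrite leq_mul// leq_sqr.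
  have -> : (X * (288 * D * X ^ 4) ^ 2 = (288 * D) ^ 2 * X ^ 9)%N by ring.
  have : (0 < (288 * D) ^ 2 * X ^ 9)%N by rewrite muln_gt0 !expn_gt0 X0 muln_gt0 D0.
  rewrite -!mulnA; lia.
have -> : (9 * (288 * D) ^ 4 * X ^ 19 = X * (3 * (288 * D) ^ 2 * X ^ 9) ^ 2)%N by ring.
by rewrite leq_mul// leq_sqr.
Qed.

Theorem theorem3 (R : realType) (delta : R) (delta_gt0 : 0 < delta) :
  exists C : R, 0 < C /\
    forall n S K : nat, (0 < n)%N -> (0 < S)%N -> (0 < K)%N ->
      let T := expR (C * n%:R * ln (n * K)%N%:R) in
      (forall A : {fset nat}, #|` A|%fset = n ->
         (forall a : nat, a \in A -> (1 <= a)%N /\ a%:R <= T) ->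
         mS R K A >= S%:R / 3 + delta) ->
      forall A : {fset nat}, #|` A|%fset = n ->
        (forall a : nat, a \in A -> (0 < a)%N) ->
        m R A >= S%:R / 3.
Proof.
pose D := Num.bound delta^-1.
have deltaD : delta^-1 < D%:R by rewrite archi_boundP// invr_ge0 ltW.
have D0 : (0 < D)%N by rewrite -(ltr0n R) (lt_trans _ deltaD)// invr_gt0.
have Ddelta : D%:R^-1 <= delta by rewrite invf_ple ?posrE ?ltr0n// ltW.
(* The exponent 19 is that of n K in [word_length_le]; the extra exponent [c] absorbs the
   coefficient [c] of that bound. *)
pose c := (9 * (288 * D) ^ 4)%N; exists (19 + c)%N%:R; split; first by rewrite ltr0n.
move=> n S K n0 S0 K0 T hT A cA A0.
have TE : T = (((n * K) ^ (19 + c)) ^ n)%N%:R.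
  rewrite /T -natrM mulrC expRM_natr lnK ?posrE ?ltr0n ?muln_gt0 ?n0//.
  by rewrite -expnM natrX.
(* For n = 1 the product n K may be 1, and its powers then absorb no constant. But then A = {a}, and
   the dilation x0 / a reduces to the set {1}. *)
rewrite {}TE {T} in hT; have [n1|n1] := eqVneq n 1%N.
  have [a Aa] : exists a, A = [fset a]%fset.
    by apply/cardfs1P; rewrite cA n1.
  have [x0 E _] := mSE R K [fset 1%N]%fset.
  have a0 : (0 < a)%N by apply: A0; rewrite Aa inE.
  apply: le_trans (_ : _ <= mS R K [fset 1%N]%fset) _.
    apply: (@le_trans _ _ (S%:R / 3 + delta)); first by rewrite lerDl ltW.
    apply: hT; first by rewrite cardfs1 n1.
    move=> b; rewrite inE => /eqP ->; split=> //.
    by rewrite ler1n !expn_gt0 muln_gt0 n0 K0.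
  rewrite E; apply: le_trans (@selberg_sum_le_m R K A (x0 / a%:R) K0 A0).
  rewrite /selberg_sum Aa !big_seq_fset1 mul1r mulrC divfK//.
  by rewrite pnatr_eq0 -lt0n.
case: n => [//|n] in n0 hT cA n1 *.
have [A' [cA' A'b A'P]] := exists_small_set K0 D0 Ddelta cA A0.
have [x0 E _] := mSE R K A'.
have [x xP] := A'P x0.
apply: le_trans (@selberg_sum_le_m R K A x K0 A0).
apply: le_trans xP; rewrite -E lerBrDr; apply: hT => // a aA'.
have /andP[a0 ab] := A'b a aA'; split=> //.
rewrite ler_nat; apply: leq_trans ab _.
set q := word_length K n.+1 D.
have X2 : (1 < n.+1 * K)%N by apply: leq_trans (leq_pmulr _ K0); rewrite ltn_neqAle eq_sym n1.
(* Uses k! <= k^k and raises the exponent of q by one, so that a single power n + 1 remains to be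
   compared. *)
apply: (@leq_trans ((n.+1 * q) ^ n.+1)).
  rewrite expnMn leq_mul//; last by rewrite leq_pexp2l// expn_gt0.
  elim: n.+1 => // k IH; rewrite factS expnS leq_mul//.
  by apply: leq_trans IH _; case: k => // k; rewrite leq_exp2r.
rewrite leq_exp2r//; apply: leq_trans (word_length_le n0 K0 D0) _.
(* As n K is at least 2 here, c <= 2^c <= (n K)^c. *)
rewrite expnD mulnC leq_mul// (@leq_trans (2 ^ c))//; first exact/ltnW/ltn_expl.
by case: (c) => // k; rewrite leq_exp2r.
Qed.
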